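(* For every positive integer $s$, let $n_s=5(2^s-1)+18\cdot 2^s$. Then $\dim_{\mathbb F_2} Q^{\otimes 5}_{n_s}=2630$.
   Context: $\mathscr A$ is the mod-2 Steenrod algebra and $\overline{\mathscr A}$ its positive-degree part. $\mathcal P_5=\mathbb F_2[x_1,\ldots,x_5]$ with $|x_i|=1$ is an $\mathscr A$-module via $Sq^k(x_j^n)=\binom nk x_j^{n+k}$ and the Cartan formula. $(\mathcal P_5)_n$ is the subspace of homogeneous polynomials of degree $n$, and $Q^{\otimes 5}_n=(\mathcal P_5)_n/((\mathcal P_5)_n\cap\overline{\mathscr A}\mathcal P_5)$ is the degree-$n$ component of $Q^{\otimes 5}=\mathbb F_2\otimes_{\mathscr A}\mathcal P_5$. *)

(* Defs.v *)
From HB Require Import structures.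
From mathcomp Require Import all_boot all_order all_algebra.
From mathcomp Require Import generic_quotient ring_quotient.
From mathcomp.multinomials Require Import mpoly.
From Stdlib Require Import ClassicalEpsilon.

Set Implicit Arguments.
Unset Strict Implicit.
Unset Printing Implicit Defensive.

Import GRing.Theory.
Local Open Scope ring_scope.

Local Notation "''P_' h" := {mpoly 'F_2[h]} (at level 8, h at level 2, format "''P_' h").

(* The iterated Cartan formula applied to x^m = \prod_i x_i^(m i): distribute
   k = \sum_i t i over the variables and use
   Sq^j (x_i^n) = 'C(n, j) x_i^(n + j). *)
Definition Sq_monomial h (k : nat) (m : 'X_{1..h}) : 'P_h :=
  \sum_(t : {ffun 'I_h -> 'I_k.+1} | (\sum_i t i)%N == k)
     \prod_i ('C(m i, t i)%:R *: 'X_i ^+ (m i + t i)).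

Definition Sq h (k : nat) (p : 'P_h) : 'P_h :=
  \sum_(m <- msupp p) p@_m *: Sq_monomial k m.

Section SqTheory.
Variable h : nat.
Implicit Types p q : 'P_h.

(* The total square \sum_k Sq^k T^k, as a ring morphism. *)
Let total_var (i : 'I_h) : {poly 'P_h} := ('X_i)%:P + ('X_i ^+ 2)%:P * 'X.
Let total : 'P_h -> {poly 'P_h} := mmap (polyC \o @mpolyC h 'F_2) total_var.

Let coef_prod_poly (I : finType) (A : comNzRingType) (P : I -> {poly A}) k :
  (\prod_i P i)`_k =
  \sum_(t : {ffun I -> 'I_k.+1} | (\sum_i t i)%N == k) \prod_i (P i)`_(t i).
Proof.
pose Q i := \poly_(j < k.+1) (P i)`_j.
have trunc j : (j < k.+1)%N -> (\prod_i P i)`_j = (\prod_i Q i)`_j.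
  elim: (index_enum I) j => [|i s IHs] j ltjk; first by rewrite !big_nil.
  rewrite !big_cons !coefM; apply: eq_bigr => l _.
  have lel : (l <= j)%N by rewrite -ltnS.
  rewrite coef_poly (leq_ltn_trans lel ltjk) IHs //.
  by rewrite (leq_ltn_trans (leq_subr _ _)).
rewrite trunc //.
have -> : \prod_i Q i = \prod_i \sum_(j < k.+1) (P i)`_j *: 'X^j.
  by apply: eq_bigr => i _; rewrite /Q poly_def.
rewrite bigA_distr_bigA coef_sum [RHS]big_mkcond; apply: eq_bigr => t _ /=.
rewrite scaler_prod prodrXr coefZ coefXn eq_sym.
by case: eqP => _; rewrite ?mulr1 ?mulr0.
Qed.

Let coef_total_var i n j :
  (total_var i ^+ n)`_j = 'C(n, j)%:R *: 'X_i ^+ (n + j).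
Proof.
have -> : total_var i = ('X_i)%:P * (1 + ('X_i)%:P * 'X).
  by rewrite mulrDr mulr1 mulrA -polyCM -expr2.
rewrite exprMn -polyC_exp coefCM exprDn coef_sum.
under eq_bigr => l _ do
  rewrite expr1n mul1r exprMn -polyC_exp coefMn coefCM coefXn.
have [lejn | ltnj] := leqP j n.
  rewrite (bigD1 (inord j : 'I_n.+1)) //= inordK // eqxx mulr1.
  rewrite big1 ?addr0; first by rewrite mulrnAr -exprD -scaler_nat.
  move=> l /eqP lj; case: eqP => [jl|]; rewrite ?mulr0 ?mul0rn //.
  by case: lj; apply: val_inj; rewrite /= inordK.
rewrite bin_small // scale0r big1 ?mulr0 // => l _.
by rewrite gtn_eqF ?mulr0 ?mul0rn // (leq_ltn_trans _ ltnj) // -ltnS.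
Qed.

Let SqE k p : Sq k p = (total p)`_k.
Proof.
rewrite /total /mmap coef_sum; apply: eq_bigr => m _ /=.
rewrite coefCM mul_mpolyC /mmap1 coef_prod_poly; congr (_ *: _).
apply: eq_bigr => t _; apply: eq_bigr => i _.
by rewrite coef_total_var.
Qed.

Lemma SqD k p q : Sq k (p + q) = Sq k p + Sq k q.
Proof. by rewrite !SqE /total mmapD coefD. Qed.

Lemma Sq_var k j n :
  Sq k ('X_j ^+ n : 'P_h) = 'C(n, k)%:R *: 'X_j ^+ (n + k).
Proof.
by rewrite SqE /total rmorphXn /= mmapX mmap1U coef_total_var.
Qed.

Lemma Sq_Cartan k p q : Sq k (p * q) = \sum_(i < k.+1) Sq i p * Sq (k - i) q.
Proof.
rewrite SqE /total rmorphM /= coefM; apply: eq_bigr => i _.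
by rewrite !SqE.
Qed.

End SqTheory.

(* [steenrod d theta]: the endomorphism theta of 'P_h is the action of an
   element of degree d of the Steenrod algebra, which is generated by the Sq^k,
   with Sq^k in degree k. *)
Inductive steenrod h : nat -> ('P_h -> 'P_h) -> Prop :=
| steenrod_Sq k : steenrod k (@Sq h k)
| steenrod1 : steenrod 0 id
| steenrodM d e theta eta :
    steenrod d theta -> steenrod e eta -> steenrod (d + e) (theta \o eta)
| steenrod0 d : steenrod d (fun=> 0)
| steenrodD d theta eta :
    steenrod d theta -> steenrod d eta ->
    steenrod d (fun p => theta p + eta p).

Inductive hit h : 'P_h -> Prop :=
| hit_steenrod d theta p : (0 < d)%N -> steenrod d theta -> hit (theta p)
| hit0 : hit 0
| hitD p q : hit p -> hit q -> hit (p + q).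

Section VspaceOf.
Variables (F : fieldType) (V : vectType F).

(* The subspace with membership predicate S; junk if S is not one. *)
Definition vspace_of (S : V -> Prop) : {vspace V} :=
  epsilon (inhabits 0%VS) (fun U => forall v, v \in U <-> S v).

Lemma mem_vspace_of (S : V -> Prop) :
    S 0 -> (forall a u v, S u -> S v -> S (a *: u + v)) ->
  forall v, v \in vspace_of S <-> S v.
Proof.
move=> S0 Slin; rewrite /vspace_of.
apply (epsilon_spec (inhabits 0%VS)
         (fun U : {vspace V} => forall v, v \in U <-> S v)).
pose sub (U : {vspace V}) := forall v, v \in U -> S v.
suff grow n (U : {vspace V}) : sub U -> (\dim {:V} <= \dim U + n)%N ->
    exists W : {vspace V}, forall v, v \in W <-> S v.
  apply: (grow (\dim {:V}) 0%VS); last by rewrite leq_addl.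
  by move=> v; rewrite memv0 => /eqP->.
elim: n U => [|n IHn] U subU dimU.
  have eqU : U == fullv by rewrite eqEdim subvf -[\dim U]addn0.
  by exists U => v; split=> [/subU|_] //; rewrite (eqP eqU) memvf.
have [[v [Sv vU]] | noext] := excluded_middle_informative
    (exists v, S v /\ v \notin U); last first.
  exists U => v; split=> [/subU //|Sv].
  by apply: contraT => vU; case: noext; exists v.
apply: (IHn (<[v]> + U)%VS) => [w|].
  by case/memv_addP=> _ /vlineP[a ->] [u /subU Su ->]; apply: Slin.
rewrite (leq_trans dimU) // -addSnnS leq_add2r ltn_neqAle dimvS ?addvSr //.
rewrite andbT; apply: contra vU => /eqP eqdim.
have /eqP-> : U == (<[v]> + U)%VS by rewrite eqEdim addvSr eqdim leqnn.
by rewrite (subvP (addvSl _ _)) ?memv_line.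
Qed.

End VspaceOf.

Section VectorQuotient.
Variables (F : fieldType) (V : vectType F) (U : {vspace V}).

Definition vquot : Type := Quotient.quot (pred_of_vspace U).
HB.instance Definition _ := EqQuotient.on vquot.
HB.instance Definition _ := GRing.Zmodule.on vquot.

Local Open Scope quotient_scope.

Lemma vquot_eq (x y : V) : (\pi_vquot x == \pi_vquot y) = (x - y \in U).
Proof. by rewrite Quotient.idealrBE. Qed.

Lemma vquot_piD (x y : V) : \pi_vquot (x + y) = \pi_vquot x + \pi_vquot y.
Proof. exact: Quotient.pi_add. Qed.

Definition vquot_scale (a : F) (q : vquot) : vquot := \pi_vquot (a *: repr q).

Lemma vquot_piZ a (x : V) : \pi_vquot (a *: x) = vquot_scale a (\pi_vquot x).
Proof.
apply/eqP; rewrite vquot_eq -scalerBr memvZ // -vquot_eq reprK.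
exact: eqxx.
Qed.

Fact vquot_scaleA a b q :
  vquot_scale a (vquot_scale b q) = vquot_scale (a * b) q.
Proof.
rewrite -[q]reprK -(vquot_piZ b (repr q)) -(vquot_piZ a (b *: repr q)).
by rewrite -vquot_piZ scalerA.
Qed.

Fact vquot_scale1 : left_id 1 vquot_scale.
Proof. by move=> q; rewrite -[q]reprK -vquot_piZ scale1r. Qed.

Fact vquot_scaleDr : right_distributive vquot_scale +%R.
Proof.
move=> a p q; rewrite -[p]reprK -[q]reprK -vquot_piD -!vquot_piZ.
by rewrite scalerDr vquot_piD.
Qed.

Fact vquot_scaleDl q : {morph vquot_scale^~ q : a b / a + b}.
Proof. by move=> a b; rewrite -[q]reprK -!vquot_piZ scalerDl vquot_piD. Qed.

HB.instance Definition _ := GRing.Zmodule_isLmodule.Build F vquot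
  vquot_scaleA vquot_scale1 vquot_scaleDr vquot_scaleDl.

Fact vquot_pi_is_linear : linear (\pi_vquot : V -> vquot).
Proof. by move=> a x y; rewrite vquot_piD vquot_piZ. Qed.
HB.instance Definition _ :=
  GRing.isLinear.Build F V vquot _ (\pi_vquot : V -> vquot) vquot_pi_is_linear.

(* A linear endomorphism of V with kernel U; it identifies V / U with its
   image. *)
Let g : 'End(V) := (\1 - projv U)%VF.

Let g_eq x y : (g x == g y) = (x - y \in U).
Proof.
have -> : (g x == g y) = (g (x - y) == 0) by rewrite linearB subr_eq0.
move: (x - y) => z; have -> : g z = z - projv U z.
  by rewrite /g add_lfunE opp_lfunE id_lfunE.
rewrite subr_eq0; apply/eqP/idP => [->|Uz]; first exact: memv_proj.
by rewrite projv_id.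
Qed.

Import VectorInternalTheory.

Let to_rV (q : vquot) := v2r (vsproj (limg g) (g (repr q))).
Let of_rV r : vquot := \pi_vquot ((g^-1)%VF (vsval (r2v r : subvs_of (limg g)))).

Let to_rV_pi x : to_rV (\pi_vquot x) = v2r (vsproj (limg g) (g x)).
Proof.
rewrite /to_rV; congr (v2r (vsproj _ _)); apply/eqP.
by rewrite g_eq -vquot_eq reprK.
Qed.

Fact vquot_vect_axiom : Vector.axiom (\dim (limg g)) vquot.
Proof.
exists to_rV => [a p q|].
  rewrite -[p]reprK -[q]reprK -vquot_pi_is_linear !to_rV_pi.
  by rewrite !linearP.
exists of_rV => [q|r].
  rewrite -[q]reprK to_rV_pi /of_rV v2rK vsprojK ?memv_img ?memvf //.
  apply/eqP; rewrite vquot_eq -g_eq limg_lfunVK //.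
  by rewrite memv_img ?memvf.
rewrite /of_rV to_rV_pi limg_lfunVK ?subvsP // vsvalK.
exact: r2vK.
Qed.

HB.instance Definition _ := Lmodule_hasFinDim.Build F vquot vquot_vect_axiom.

Lemma dim_vquot : \dim {:vquot} = (\dim {:V} - \dim U)%N.
Proof.
have kerg : lker g = U.
  apply/vspaceP => x.
  by rewrite memv_ker -[0 in LHS](linear0 g) g_eq subr0.
by rewrite -(limg_ker_dim g fullv) capfv kerg addKn dimvf.
Qed.

End VectorQuotient.

(* The intersection of (P_h)_n with the hit polynomials. The library provides
   the finite-dimensional structure on [dhomog h R n] for h > 0 only, whence the
   index h.+1. *)
Definition hit_vs h n : {vspace dhomog h.+1 'F_2 n} :=
  vspace_of (fun p : dhomog h.+1 'F_2 n => hit (p : 'P_h.+1)).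

Lemma mem_hit_vs h n (p : dhomog h.+1 'F_2 n) :
  p \in hit_vs h n <-> hit (p : 'P_h.+1).
Proof.
apply: (mem_vspace_of (S := fun p : dhomog h.+1 'F_2 n => hit (p : 'P_h.+1))).
  exact: hit0.
move=> a u v hu hv.
change (hit (a *: (u : 'P_h.+1) + (v : 'P_h.+1))); apply: hitD => //.
have [->|->] : a = 0 \/ a = 1.
  by case: a => [[|[|[]]] //] ?; [left | right]; apply: val_inj.
  by rewrite scale0r; apply: hit0.
by rewrite scale1r.
Qed.

Definition Q5 n : vectType 'F_2 :=
  vquot (hit_vs 4 n : {vspace dhomog 5 'F_2 n}).

(* Main.v *)
(* A monomial is x_S y^2, S being the set of the variables with odd exponent. It
   is hit unless |S| + deg y is a sum of |S| powers of 2. For s > 1 this leaves,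
   in degree n_s, only |S| = 5, so that Kameko's map x_1 ... x_5 y^2 -> y is an
   isomorphism onto the quotient in degree n_(s-1). This reduces the theorem to
   degree 41.

   There the monomials with |S| = 1 are hit and, modulo them, the hit
   polynomials are spanned by x_S (Sq^k v)^2 with |S| = 3,
   x_1 ... x_5 (Sq^(2k) v)^2, Sq^1 (x_S u^2) with |S| = 4 and
   Sq^2 (x_1 ... x_5 u^2). The first two families reduce the remaining monomials
   to ten copies of a basis of P_19 modulo the image of the Sq^k and one of a
   basis of P_18 modulo that of the Sq^(2k). The other two families become
   linear relations between these, in which the Adem relations allow u to be
   taken in a complement of the image of the Sq^(2k), resp. of Sq^1. Gaussian
   elimination over F_2 is then run by evaluation.

   Only two facts are needed about its result, and both hold by construction:
   the rows span the hit polynomials, and the monomials that are not the leading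
   one of a row span the quotient. Since there are 2630 such monomials and
   C(45, 4) - 2630 rows, the dimension is 2630 without any proof that the rows
   or the monomials are independent. *)

From HB Require Import structures.
Require Import Defs.
From mathcomp Require Import all_boot all_order all_algebra.
From mathcomp.multinomials Require Import mpoly.
From mathcomp Require Import zify ring.

Set Implicit Arguments.
Unset Strict Implicit.
Unset Printing Implicit Defensive.

Import GRing.Theory.
Local Open Scope ring_scope.

Local Notation P := {mpoly 'F_2[5]}.

(** * Steenrod squares of monomials *)

Lemma addPP (p : P) : p + p = 0.
Proof.
have c2 : 2 \in [pchar P]; last exact: (addrr_pchar2 c2).
by rewrite inE /= -mpolyC_nat mpolyC_eq0; apply/eqP/val_inj.
Qed.

Lemma addPK (p q : P) : p + q + q = p.
Proof. by rewrite -addrA addPP addr0. Qed.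

Lemma sqrPD (p q : P) : (p + q) ^+ 2 = p ^+ 2 + q ^+ 2.
Proof. by rewrite sqrrD mulr2n addPP addr0. Qed.

Lemma scaleF2 (a : 'F_2) (p : P) : a *: p = if a == 0 then 0 else p.
Proof.
have [->|a0] := eqVneq a 0; first exact: scale0r.
suff -> : a = 1 by rewrite scale1r.
by case: a a0 => [[|[|[]]] //] lta _; apply: val_inj.
Qed.

Lemma natrP (n : nat) : n%:R = (odd n)%:R :> P.
Proof.
by rewrite -[in LHS](odd_double_half n) natrD -addnn natrD addPP addr0.
Qed.

Definition X (i : nat) : P := 'X_(inord i).

Definition mono (ys : seq nat) : P := \prod_(i <- iota 0 5) X i ^+ nth 0%N ys i.

Lemma mpolyX_mono (m : 'X_{1..5}) : 'X_[m] = mono [seq m i | i <- enum 'I_5].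
Proof.
rewrite mpolyXE_id /mono -[iota 0 5]val_enum_ord big_map big_enum /=.
apply: eq_bigr => i _; rewrite /X inord_val (nth_map i) ?size_enum_ord //.
by rewrite nth_ord_enum.
Qed.

Lemma mono_ind (K : P -> Prop) :
    K 0 -> (forall p q, K p -> K q -> K (p + q)) ->
    (forall ys, size ys = 5%N -> K (mono ys)) -> forall p, K p.
Proof.
move=> K0 KD KX; elim/mpolyind => // a m p _ _ Kp; apply: KD => //.
rewrite scaleF2; case: eqP => // _.
by rewrite mpolyX_mono; apply: KX; rewrite size_map size_enum_ord.
Qed.

(** Besides sums, only multiplication by one variable is left to check, and there the Cartan formula
    has just the two terms of [Sq_mulX]. *)
Lemma P_ind (K : P -> Prop) :
    K 0 -> (forall p q, K p -> K q -> K (p + q)) -> K 1 ->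
    (forall i p, K p -> K (X i * p)) -> forall p, K p.
Proof.
move=> K0 KD K1 KX; apply: mono_ind => // ys _; rewrite /mono.
elim: (iota _ _) => [|i s IHs]; rewrite ?big_nil // big_cons.
by elim: (nth _ _ _) => [|n IHn]; rewrite ?mul1r // exprS -mulrA; apply: KX.
Qed.

Implicit Types p q u v w : P.

Lemma Sq0r k : Sq k (0 : P) = 0.
Proof. by apply: (addrI (Sq k (0 : P))); rewrite -SqD !addr0. Qed.

Lemma Sq1r k : Sq k (1 : P) = (k == 0)%:R.
Proof.
rewrite -(expr0 ('X_ord0 : P)) Sq_var.
by case: k => [|k]; rewrite ?bin0 ?scale1r ?addn0 // bin0n scale0r.
Qed.

Lemma Sq_mulX0 i p : Sq 0 (X i * p) = X i * Sq 0 p.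
Proof.
rewrite Sq_Cartan big_ord1 -[X in Sq _ X]expr1 Sq_var.
by rewrite bin0 scale1r addn0 expr1.
Qed.

Lemma Sq_mulX k i p : Sq k.+1 (X i * p) = X i * Sq k.+1 p + X i ^+ 2 * Sq k p.
Proof.
rewrite Sq_Cartan 2!big_ord_recl big1 => [|j _] /=; last first.
  by rewrite -[X in Sq _ X]expr1 Sq_var bin_small ?scale0r ?mul0r.
rewrite -[X in Sq 0 X]expr1 -[X in Sq (bump _ _) X]expr1 !Sq_var.
by rewrite bin0 bin1 !scale1r addr0 addn0 expr1 subn0 /= subSS subn0.
Qed.

Lemma Sq0 p : Sq 0 p = p.
Proof.
move: p; apply: P_ind => [|p q IHp IHq||i p IHp].
- exact: Sq0r.
- by rewrite SqD IHp IHq.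
- by rewrite Sq1r.
- by rewrite Sq_mulX0 IHp.
Qed.

(* The instances Sq^1 Sq^k = (k + 1) Sq^(k + 1) of the Adem relations. *)
Lemma Sq1Sq k p : Sq 1 (Sq k p) = if odd k then 0 else Sq k.+1 p.
Proof.
elim/P_ind: p k => [|p q IHp IHq||i p IHp] k.
- by rewrite !Sq0r if_same.
- by rewrite !SqD IHp IHq; case: ifP; rewrite ?addr0.
- rewrite !Sq1r; case: k => [|k]; first by rewrite Sq1r.
  by rewrite Sq0r if_same.
case: k => [|k]; first by rewrite !Sq0.
rewrite !Sq_mulX SqD expr2 -!mulrA !Sq_mulX !Sq0 !IHp /=.
case: odd => /=; rewrite ?mulr0 ?addr0 ?add0r.
  by rewrite !expr2 -!mulrA addPP addr0.
by rewrite !expr2 -!mulrA !mulrDr addPK addPP.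
Qed.

(** The two cross terms [X i ^+ 3 * Sq k.+1 p] cancel in characteristic 2. *)
Lemma Sq_mulX2 k i p :
  Sq k.+2 (X i ^+ 2 * p) = X i ^+ 2 * Sq k.+2 p + X i ^+ 4 * Sq k p.
Proof.
rewrite [X i ^+ 2 in LHS]expr2 -mulrA !Sq_mulX !mulrDr !mulrA -exprSr -expr2.
by rewrite -exprSr addrA addPK.
Qed.

Lemma Sq1_mulX2 i p : Sq 1 (X i ^+ 2 * p) = X i ^+ 2 * Sq 1 p.
Proof.
by rewrite [X i ^+ 2 in LHS]expr2 -mulrA !Sq_mulX !Sq0 mulrDr !mulrA -exprSr addPK.
Qed.

Lemma Sq_sqr k p : Sq k (p ^+ 2) = if odd k then 0 else Sq k./2 p ^+ 2.
Proof.
elim/P_ind: p k => [|p q IHp IHq||i p IHp] k.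
- by rewrite expr0n !Sq0r expr0n if_same.
- by rewrite sqrPD !SqD IHp IHq; case: ifP; rewrite ?addr0 // sqrPD.
- rewrite expr1n !Sq1r; case: k => [|[|k]] //=; first by rewrite expr1n.
  by rewrite expr0n if_same.
rewrite exprMn; case: k => [|[|k]]; first by rewrite !Sq0 exprMn.
  by rewrite Sq1_mulX2 IHp mulr0.
rewrite Sq_mulX2 !IHp /= negbK; case: odd; first by rewrite !mulr0 addr0.
by rewrite Sq_mulX sqrPD !exprMn -exprD.
Qed.

Lemma homog_ind (K : nat -> P -> Prop) :
    (forall d, K d 0) -> (forall d p q, K d p -> K d q -> K d (p + q)) ->
    K 0%N 1 -> (forall d i p, K d p -> K d.+1 (X i * p)) ->
  forall d p, p \is d.-homog -> K d p.
Proof.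
move=> K0 KD K1 KX d p /dhomogP hp; rewrite [p]mpolyE big_seq.
elim/big_ind: _ => // [q r|m /hp <-]; first exact: KD.
rewrite scaleF2; case: eqP => // _; rewrite mpolyXE_id.
suff: K (\sum_i m i)%N (\prod_i ('X_i : P) ^+ m i) by rewrite -mdegE.
elim: (index_enum _) => [|i s IHs]; rewrite ?big_nil // !big_cons.
have -> : 'X_i = X i by rewrite /X inord_val.
by elim: (m i) => [|n IHn]; rewrite ?mul1r // exprS -mulrA; apply: KX.
Qed.

Lemma X_homog i : X i \is 1.-homog.
Proof. by rewrite dhomogX; apply/eqP; exact: mdeg1. Qed.

Lemma Sq_homog k d p : p \is d.-homog -> Sq k p \is (d + k).-homog.
Proof.
move=> hp; elim/homog_ind: d p / hp k => [d|d p q IHp IHq||d i p IHp] k.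
- by rewrite Sq0r dhomog0.
- by rewrite SqD dhomogD.
- by rewrite Sq1r; case: k => [|k]; rewrite ?dhomog1 ?dhomog0.
case: k => [|k]; first by have := IHp 0%N;
  rewrite !Sq0 !addn0 => /(dhomogM (X_homog i)).
rewrite Sq_mulX dhomogD //.
  by rewrite addSn; apply: (dhomogM (X_homog i) (IHp k.+1)).
have -> : (d.+1 + k.+1 = 1 * 2 + (d + k))%N by rewrite addSn addnS mul1n.
by apply: dhomogM (IHp k); apply/dhomogMn/X_homog.
Qed.

(** The instability condition: multiplying by X_i raises the degree by one and lets the squares
    reach one step further, through the term X_i^2 Sq^k p. *)
Lemma Sq_top d p :
  p \is d.-homog -> Sq d p = p ^+ 2 /\ (forall k, (d < k)%N -> Sq k p = 0).
Proof.
move=> hp; elim/homog_ind: d p / hp => [d|d p q [tp gp] [tq gq]||d i p [tp gp]].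
- by rewrite Sq0r expr0n; split=> // k _; rewrite Sq0r.
- by split=> [|k ltdk]; rewrite SqD ?tp ?tq ?sqrPD // gp // gq // addr0.
- by rewrite Sq1r expr1n; split=> // -[|k] // _; rewrite Sq1r.
split=> [|[|k] // ltdk]; rewrite Sq_mulX.
  by rewrite gp // mulr0 add0r tp exprMn.
by rewrite !gp ?mulr0 ?addr0 // ltnW.
Qed.

(** Under Sq^k each variable of a square-free monomial is either kept, and goes to the first list,
    or squared, and goes to the second one. *)
Fixpoint splits (s : seq nat) : seq (seq nat * seq nat) :=
  if s is i :: s' then
    [seq (ut.1, i :: ut.2) | ut <- splits s'] ++
    [seq (i :: ut.1, ut.2) | ut <- splits s']
  else [:: ([::], [::])].

Definition sqfree (s : seq nat) : P := \prod_(i <- s) X i.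

(** What remains for p^2 once n variables have been squared: for n <= k, Sq^(k-n) (p^2) is the
    square of this polynomial by [Sq_sqr]. *)
Definition Sqhalf k n p : P :=
  if (n <= k)%N && ~~ odd (k - n) then Sq (k - n)./2 p else 0.

Lemma Sq_sqfree_sqr k s p :
  Sq k (sqfree s * p ^+ 2) =
  \sum_(ut <- splits s) sqfree ut.1 * (sqfree ut.2 * Sqhalf k (size ut.2) p) ^+ 2.
Proof.
elim: s k => [|i s IHs] k.
  rewrite big_seq1 /sqfree !big_nil !mul1r Sq_sqr /Sqhalf subn0 /=.
  by case: odd; rewrite ?expr0n.
rewrite /sqfree big_cons -/(sqfree s) -mulrA big_cat !big_map /=.
case: k => [|k].
  rewrite Sq_mulX0 IHs big_distrr /= [X in X + _]big1 ?add0r => [|ut _].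
    by apply: eq_bigr => ut _; rewrite /sqfree big_cons mulrA.
  by rewrite /Sqhalf /= mulr0 expr0n mulr0.
rewrite Sq_mulX !IHs !big_distrr [RHS]addrC /=; congr (_ + _).
  by apply: eq_bigr => ut _; rewrite big_cons mulrA.
apply: eq_bigr => ut _; rewrite /Sqhalf ltnS subSS big_cons.
by rewrite mulrCA; congr (_ * _); rewrite -exprMn mulrA.
Qed.

(** * Hit polynomials as sums of values of the Sq^k *)

Lemma hit_Sq k p : (0 < k)%N -> hit (Sq k p).
Proof. by move=> k0; apply: hit_steenrod k0 _; apply: steenrod_Sq. Qed.

Lemma hit_sum (I : Type) (s : seq I) (Q : pred I) (F : I -> P) :
  (forall i, Q i -> hit (F i)) -> hit (\sum_(i <- s | Q i) F i).
Proof. by move=> hF; elim/big_ind: _ => //; [apply: hit0 | apply: hitD]. Qed.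

Lemma hit_addr p q : hit q -> hit (p + q) -> hit p.
Proof. by move=> hq hpq; rewrite -[p](addPK p q); apply: hitD. Qed.

(** In a composite of positive degree, either the left factor has positive degree, or it has degree
    0 and acts as the identity or as 0. The induction carries this description of degree 0 along. *)
Lemma hit_rec (K : P -> Prop) :
    K 0 -> (forall p q, K p -> K q -> K (p + q)) ->
    (forall k p, (0 < k)%N -> K (Sq k p)) ->
  forall p, hit p -> K p.
Proof.
move=> K0 KD KSq p; elim=> {p} [d theta p d_gt0 st|//|p q _ IHp _]; last exact: KD.
suff: ((0 < d)%N -> forall p, K (theta p)) /\
      (d = 0%N -> (forall p, theta p = p) \/ (forall p, theta p = 0)).
  by case=> + _; apply.
elim: st => {d theta d_gt0 p} [k||d e theta eta _ [IHd IHd0] _ [IHe IHe0]|d|].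
- by split=> [k0 p|->]; [apply: KSq | left=> p; apply: Sq0].
- by split=> // _; left.
- split=> [|/eqP].
    case: d IHd IHd0 => [|d] IHd IHd0 h p /=; last exact: IHd.
    by case: (IHd0 erefl) => ->; [apply: IHe | apply: K0].
  rewrite addn_eq0 => /andP[/eqP d0 /eqP e0].
  case: (IHd0 d0) => td; last by right=> p /=; rewrite td.
  by case: (IHe0 e0) => te; [left | right] => p /=; rewrite td te.
- by split=> // _; right.
- move=> d theta eta _ [IHd IHd0] _ [IHe IHe0]; split=> [d0 p|d0].
    by apply: KD; [apply: IHd | apply: IHe].
  case: (IHd0 d0) => td; case: (IHe0 d0) => te; [right|left|left|right] => p;
    by rewrite td te ?addPP ?addr0 ?add0r.
Qed.

(** * A criterion for a monomial to be hit *)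

Definition pow2_sum (j d : nat) : Prop :=
  exists2 s : seq nat, size s = j & d = (\sum_(a <- s) 2 ^ a)%N.

Lemma pow2_sumS j d a : pow2_sum j d -> pow2_sum j.+1 (2 ^ a + d).
Proof. by case=> s <- ->; exists (a :: s); rewrite ?big_cons. Qed.

Lemma pow2_sum0 d : pow2_sum 0 d -> d = 0%N.
Proof. by case=> -[|//] _ ->; rewrite big_nil. Qed.

(** [z] counts the summands equal to 1; the others are halved. As the parity of d restricts [z],
    this gives a descent for showing that d is no such sum. *)
Lemma pow2_sum_half j d : pow2_sum j d ->
  exists z e, [/\ (z <= j)%N, d = (z + e.*2)%N & pow2_sum (j - z) e].
Proof.
case=> s; elim: s j d => [|a s IHs] [|j] d //=.
  by rewrite big_nil => _ ->; exists 0%N, 0%N; split=> //; exists [::];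
    rewrite ?big_nil.
case=> szs; rewrite big_cons; have [z [e [lezj ds es]]] := IHs _ _ szs erefl.
move=> ->; rewrite ds; case: a => [|a]; first by exists z.+1, e.
exists z, (2 ^ a + e)%N; rewrite subSn //; split; first exact: leqW.
  by rewrite expnS mul2n doubleD addnCA.
exact: pow2_sumS.
Qed.

(** The span of the products of j factors x_i^(2^a) of total degree d. A square Sq^k keeps, squares
    or kills such a factor, so that j is invariant while d grows by k. *)
Inductive pow2_prod : nat -> nat -> P -> Prop :=
| pow2_prod1 : pow2_prod 0 0 1
| pow2_prodM j d a i u : pow2_prod j d u ->
    pow2_prod j.+1 (2 ^ a + d) (X i ^+ (2 ^ a) * u)
| pow2_prod0 j d : pow2_prod j d 0
| pow2_prodD j d u v : pow2_prod j d u -> pow2_prod j d v ->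
    pow2_prod j d (u + v).

Lemma pow2_prod_sum j d u : pow2_prod j d u -> u = 0 \/ pow2_sum j d.
Proof.
elim=> {j d u} [|j d a i u _ [->|sd]|j d|j d u v _ [->|sd] _ [->|sd']].
- by right; exists [::]; rewrite ?big_nil.
- by left; rewrite mulr0.
- by right; apply: pow2_sumS.
- by left.
all: by rewrite ?addr0; auto.
Qed.

Lemma Sq_pow2 k i a : Sq k (X i ^+ (2 ^ a)) =
  if k == 0%N then X i ^+ (2 ^ a) else
  if k == (2 ^ a)%N then X i ^+ (2 ^ a.+1) else 0.
Proof.
elim: a k => [|a IHa] k.
  rewrite Sq_var; case: k => [|[|k]] /=.
  - by rewrite scale1r.
  - by rewrite bin1 scale1r.
  - by rewrite bin_small ?scale0r.
rewrite expnSr exprM Sq_sqr IHa; case: k => [|[|k]] //=.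
  by case: eqP => // /(congr1 odd); rewrite muln2 odd_double.
rewrite -[in RHS](odd_double_half k) negbK; case: odd => /=.
  by case: eqP => // /(congr1 odd); rewrite /= muln2 !odd_double.
rewrite add0n -doubleS -muln2 eqn_pmul2r //.
by case: eqP => _; rewrite ?expr0n // -exprM -expnSr.
Qed.

Lemma pow2_prod_Sq j d u k : pow2_prod j d u -> pow2_prod j (d + k) (Sq k u).
Proof.
move=> ju; elim: ju k => {j d u} [|j d a i u _ IHu|j d|j d u v _ IHu _ IHv] k.
- by rewrite Sq1r; case: k => [|k]; [apply: pow2_prod1 | apply: pow2_prod0].
- rewrite Sq_Cartan; elim/big_ind: _ => [|x y|l _].
  + exact: pow2_prod0.
  + exact: pow2_prodD.
  rewrite Sq_pow2; case: eqP => [->|_].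
    by rewrite subn0 -addnA; apply/pow2_prodM/IHu.
  case: eqP => [el|_]; last by rewrite mul0r; apply: pow2_prod0.
  have -> : (2 ^ a + d + k = 2 ^ a.+1 + (d + (k - l)))%N.
    rewrite expnS mul2n -addnn -!addnA; congr (_ + _)%N.
    by rewrite addnCA -el subnKC // -ltnS.
  exact/pow2_prodM/IHu.
- by rewrite Sq0r; apply: pow2_prod0.
- by rewrite SqD; apply: pow2_prodD.
Qed.

(* By the Cartan formula u Sq^k f is, modulo hit elements, the sum of the
   (Sq^i u) (Sq^(k-i) f) for 0 < i <= k, and these terms have the same value of
   d + k; the descent stops at k = 0, where d is a sum of j powers of 2. *)
Lemma hit_pow2_prod_mul j d u k f :
  pow2_prod j d u -> ~ pow2_sum j (d + k) -> hit (u * Sq k f).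
Proof.
elim/ltn_ind: k d u f => -[|k] IHk d u f ju nsum.
  case: (pow2_prod_sum ju) => [->|]; first by rewrite mul0r; apply: hit0.
  by rewrite -(addn0 d).
apply: (@hit_addr _ (\sum_(i < k.+1) Sq i.+1 u * Sq (k - i) f)); last first.
  have := @hit_Sq k.+1 (u * f) isT; rewrite Sq_Cartan big_ord_recl Sq0 subn0.
  by under eq_bigr do rewrite /= subSS.
apply: hit_sum => i _; apply: (IHk _ _ (d + i.+1)%N).
- by rewrite ltnS leq_subr.
- exact: pow2_prod_Sq.
- by rewrite -addnA addSn subnKC // -ltnS.
Qed.

Lemma pow2_prod_sqfree s : pow2_prod (size s) (size s) (sqfree s).
Proof.
elim: s => [|i s IHs]; first by rewrite /sqfree big_nil; apply: pow2_prod1.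
by rewrite /sqfree big_cons /= -add1n; apply: (pow2_prodM 0 i IHs).
Qed.

(** By [Sq_top], w^2 is Sq^d w, and x_S is a product of |S| factors x_i^(2^0). *)
Lemma hit_sqfree_sqr s d w : w \is d.-homog ->
  ~ pow2_sum (size s) (size s + d) -> hit (sqfree s * w ^+ 2).
Proof.
move=> /Sq_top[<- _]; exact/hit_pow2_prod_mul/pow2_prod_sqfree.
Qed.

Lemma monoE ys : mono ys = 'X_[[multinom nth 0%N ys i | i < 5]].
Proof.
rewrite mpolyXE_id /mono -[iota 0 5]val_enum_ord big_map big_enum /=.
by apply: eq_bigr => i _; rewrite /X inord_val mnmE.
Qed.

Lemma mono_homog ys : size ys = 5%N -> mono ys \is (sumn ys).-homog.
Proof.
move=> sz; rewrite monoE dhomogX.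
suff : mdeg [multinom nth 0%N ys i | i < 5] = sumn ys by move=> <-.
rewrite mdegE sumnE (big_nth 0%N) big_mkord sz.
by apply: eq_bigr => i _; rewrite mnmE.
Qed.

Lemma homog_mono_ind n (K : P -> Prop) :
    K 0 -> (forall p q, K p -> K q -> K (p + q)) ->
    (forall ys, size ys = 5%N -> sumn ys = n -> K (mono ys)) ->
  forall p, p \is n.-homog -> K p.
Proof.
move=> K0 KD Km p /dhomogP hp; rewrite [p]mpolyE big_seq.
elim/big_ind: _ => // m /hp mn; rewrite scaleF2; case: eqP => // _.
rewrite mpolyX_mono; apply: Km; first by rewrite size_map size_enum_ord.
by rewrite -mn sumnE big_map big_enum; apply/esym; exact: mdegE.
Qed.

(** A hit polynomial may come from inhomogeneous ones. But Sq^k of a monomial is homogeneous, so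
    that taking the component of degree n keeps or kills it as a whole. *)
Lemma hit_pihomog_rec n (K : P -> Prop) :
    K 0 -> (forall p q, K p -> K q -> K (p + q)) ->
    (forall k ys, (0 < k)%N -> size ys = 5%N -> (sumn ys + k)%N = n ->
       K (Sq k (mono ys))) ->
  forall p, hit p -> K (pihomog mdeg n p).
Proof.
move=> K0 KD KSq p; elim/hit_rec: p / => [|p q Kp Kq|k p k_gt0].
- by rewrite pihomog0; exact: K0.
- by rewrite pihomogD; exact: KD.
elim/mono_ind: p => [|p q Kp Kq|ys sz].
- by rewrite Sq0r pihomog0; exact: K0.
- by rewrite SqD pihomogD; exact: KD.
have hS := Sq_homog k (mono_homog sz).
have [en|ne] := eqVneq (sumn ys + k)%N n; last first.
  by rewrite (pihomog_ne0 ne hS); exact: K0.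
by rewrite pihomog_dE -?en //; apply: KSq.
Qed.

Definition odds (ys : seq nat) := [seq i <- iota 0 5 | odd (nth 0%N ys i)].

Lemma mono_split ys :
  size ys = 5%N -> mono ys = sqfree (odds ys) * mono (map half ys) ^+ 2.
Proof.
move=> sz; rewrite /mono /sqfree /odds big_filter [X in X * _]big_mkcond.
rewrite -prodrXl -big_split; apply: eq_big_seq => i; rewrite mem_iota => lti.
rewrite (nth_map 0%N) ?sz // -exprM muln2 /=.
by rewrite -[in LHS](odd_double_half (nth 0%N ys i)) exprD; case: odd.
Qed.

Lemma sumn_split ys :
  size ys = 5%N -> sumn ys = (size (odds ys) + (sumn (map half ys)).*2)%N.
Proof.
case: ys => [|a [|b [|c [|d [|e [|]]]]]] //= _.
rewrite /odds /= -{1}(odd_double_half a) -{1}(odd_double_half b).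
rewrite -{1}(odd_double_half c) -{1}(odd_double_half d).
rewrite -{1}(odd_double_half e) !doubleD addn0.
by case: (odd a); case: (odd b); case: (odd c); case: (odd d); case: (odd e);
  rewrite /= ?addn0 ?add0n !addnA; lia.
Qed.

Lemma hit_mono ys : size ys = 5%N ->
    ~ pow2_sum (size (odds ys)) (size (odds ys) + sumn (map half ys)) ->
  hit (mono ys).
Proof.
move=> sz nsum; rewrite mono_split //; apply: hit_sqfree_sqr nsum.
by apply: mono_homog; rewrite size_map.
Qed.

Lemma size_odds ys : (size (odds ys) <= 5%N)%N.
Proof. by rewrite size_filter (leq_trans (count_size _ _)). Qed.

Lemma odds_full ys : size (odds ys) = 5%N -> odds ys = iota 0 5.
Proof.
by move=> sz; apply/eqP; rewrite -size_subseq_leqif ?filter_subseq ?sz.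
Qed.

(** * Kameko's map *)

Lemma splits_subseq s ut : ut \in splits s -> subseq ut.1 s.
Proof.
elim: s ut => [|i s IHs] ut /=; first by rewrite inE => /eqP->.
rewrite mem_cat => /orP[] /mapP[[u t] /IHs /= us ->] /=; last by rewrite eqxx.
exact: subseq_trans us (subseq_cons _ _).
Qed.

Lemma big_splits_id (s : seq nat) (F : seq nat * seq nat -> P) :
  \sum_(ut <- splits s | ut.1 == s) F ut = F (s, [::]).
Proof.
elim: s F => [|i s IHs] F; first by rewrite big_cons big_nil eqxx addr0.
rewrite /= big_cat !big_map /= [X in X + _]big_seq_cond [X in X + _]big1.
  rewrite add0r -(IHs (fun ut => F (i :: ut.1, ut.2))).
  by apply: eq_bigl => ut; rewrite eqseq_cons eqxx.
move=> [u t] /andP[/splits_subseq/= /size_subseq szu /eqP su].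
by rewrite su ltnn in szu.
Qed.

Definition odd_mnm (m : 'X_{1..5}) : 'X_{1..5} := [multinom (m i).*2.+1 | i < 5].

(* Kameko's map: X_0 ... X_4 y^2 goes to y and the other monomials to 0. The
   bound d on the degree of y keeps the sum finite. *)
Definition kameko d p : P :=
  \sum_(m : 'X_{1..5 < d.+1}) p@_(odd_mnm m) *: 'X_[m].

Lemma kameko_is_linear d : linear (kameko d).
Proof.
move=> a p q; rewrite /kameko scaler_sumr -big_split; apply: eq_bigr => m _ /=.
by rewrite mcoeffD mcoeffZ scalerDl scalerA.
Qed.
HB.instance Definition _ d :=
  GRing.isLinear.Build 'F_2 P P _ (kameko d) (kameko_is_linear d).

Lemma mcoeff_kameko d p (m : 'X_{1..5}) :
  (kameko d p)@_m = if (mdeg m < d.+1)%N then p@_(odd_mnm m) else 0.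
Proof.
rewrite /kameko linear_sum /=; case: ifPn => ltm.
  rewrite (bigD1 (BMultinom ltm)) //= mcoeffZ mcoeffX eqxx mulr1.
  rewrite big1 ?addr0 // => m' nem; rewrite mcoeffZ mcoeffX.
  have /negPf-> : bmnm m' != m by rewrite -val_eqE in nem.
  by rewrite mulr0.
apply: big1 => m' _; rewrite mcoeffZ mcoeffX; case: eqP => [em|_].
  by case/negP: ltm; rewrite -em bmdeg.
by rewrite mulr0.
Qed.

Lemma sqfree_mul_mono s zs : subseq s (iota 0 5) ->
  sqfree s * mono zs ^+ 2 =
  'X_[[multinom ((val i \in s) + (nth 0%N zs i).*2)%N | i < 5]].
Proof.
move=> /subseq_uniqP-/(_ (iota_uniq 0 5)) ss.
transitivity (mono [seq ((i \in s) + (nth 0%N zs i).*2)%N | i <- iota 0 5]).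
  rewrite [in LHS]ss /mono /sqfree big_filter [X in X * _]big_mkcond.
  rewrite -prodrXl -big_split; apply: eq_big_seq => i; rewrite mem_iota => lti.
  rewrite (nth_map 0%N) ?size_iota // nth_iota // add0n exprD -muln2 exprM /=.
  by case: (i \in s).
rewrite monoE; congr 'X_[_]; apply/mnmP => i; rewrite !mnmE.
by rewrite (nth_map 0%N) ?size_iota // nth_iota.
Qed.

(** A variable outside s has even exponent in every monomial of the product. *)
Lemma kameko_low d s p :
  subseq s (iota 0 5) -> (size s < 5)%N -> kameko d (sqfree s * p ^+ 2) = 0.
Proof.
move=> ss szs; have [i lti nsi] : exists2 i, (i < 5)%N & i \notin s.
  have /allPn[i] : ~~ all (mem s) (iota 0 5).
    apply: contraL szs => /allP sub; rewrite -leqNgt.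
    exact: (uniq_leq_size (iota_uniq 0 5) sub).
  by rewrite mem_iota; exists i.
elim/mono_ind: p => [|p q IHp IHq|zs _].
- by rewrite expr0n mulr0 linear0.
- by rewrite sqrPD mulrDr linearD /= IHp IHq addr0.
apply/mpolyP => m; rewrite mcoeff_kameko mcoeff0 sqfree_mul_mono // mcoeffX.
case: ifP => // _; case: eqP => // /mnmP/(_ (Ordinal lti))/(congr1 odd).
by rewrite !mnmE /= (negPf nsi) !odd_double.
Qed.

Lemma kameko_full d e p : p \is e.-homog ->
  kameko d (sqfree (iota 0 5) * p ^+ 2) = if (e <= d)%N then p else 0.
Proof.
move=> hp; apply/mpolyP => m; rewrite mcoeff_kameko.
have -> : (sqfree (iota 0 5) * p ^+ 2)@_(odd_mnm m) = p@_m.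
  elim/mono_ind: p {hp} => [|p q IHp IHq|zs _].
  - by rewrite expr0n mulr0 !mcoeff0.
  - by rewrite sqrPD mulrDr !mcoeffD IHp IHq.
  rewrite sqfree_mul_mono ?subseq_refl // monoE !mcoeffX; congr (_%:R).
  apply: (congr1 nat_of_bool); apply/eqP/eqP => [/mnmP em|<-]; apply/mnmP => i.
    by have := em i; rewrite !mnmE mem_iota ltn_ord => -[/double_inj].
  by rewrite !mnmE mem_iota ltn_ord.
rewrite ltnS; have [->|nem] := eqVneq (mdeg m) e.
  by case: ifP => //; rewrite mcoeff0.
by rewrite (dhomog_nemf_coeff hp nem) if_same; case: ifP;
  rewrite ?mcoeff0 ?(dhomog_nemf_coeff hp nem).
Qed.

(** In every other term of [Sq_sqfree_sqr] some variable of s has been squared, which leaves fewer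
    than five odd exponents, and [kameko_low] applies. *)
Lemma kameko_Sq d k s p : subseq s (iota 0 5) ->
  kameko d (Sq k (sqfree s * p ^+ 2)) =
  kameko d (sqfree s * Sqhalf k 0 p ^+ 2).
Proof.
move=> ss; rewrite Sq_sqfree_sqr (bigID (fun ut => ut.1 == s)) /=.
rewrite big_splits_id linearD /= [X in _ + X]linear_sum /= big_seq_cond big1.
  by rewrite addr0 {2}/sqfree big_nil mul1r.
move=> [u t] /andP[/splits_subseq/= us nus].
apply: kameko_low; first exact: subseq_trans us ss.
apply: leq_trans (size_subseq ss); rewrite ltn_neqAle size_subseq // andbT.
by apply: contra nus; rewrite (size_subseq_leqif us).
Qed.

(** The image of Sq^k (x_S y^2) is 0 unless |S| = 5 and k is even, when it is Sq^(k/2) y, or 0 if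
    this exceeds the degree bound. *)
Lemma hit_kameko d p : hit p -> hit (kameko d p).
Proof.
elim/hit_rec: p / => [|p q|k p k_gt0].
- by rewrite linear0; apply: hit0.
- by rewrite linearD; apply: hitD.
elim/mono_ind: p => [|p q hp hq|ys sz].
- by rewrite Sq0r linear0; apply: hit0.
- by rewrite SqD linearD; apply: hitD.
have hz := mono_homog (etrans (size_map half ys) sz).
have os : subseq (odds ys) (iota 0 5) by apply: filter_subseq.
rewrite mono_split // kameko_Sq //.
have [lt5|ge5] := ltnP (size (odds ys)) 5.
  by rewrite kameko_low //; apply: hit0.
rewrite odds_full; last by apply/eqP; rewrite eqn_leq size_odds.
rewrite /Sqhalf subn0 /=; have [odk|evk] := boolP (odd k).
  by rewrite expr0n mulr0 linear0; apply: hit0.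
rewrite (kameko_full _ (Sq_homog k./2 hz)); case: ifP => _; last exact: hit0.
by apply: hit_Sq; case: k k_gt0 evk => [|[|k]].
Qed.

Lemma kameko_homog d p :
  p \is (d.*2 + 5).-homog -> kameko d p \is d.-homog.
Proof.
move=> hp; apply/dhomogP => m; rewrite mcoeff_msupp mcoeff_kameko.
case: ifP => [_ nz|]; last by rewrite eqxx.
have dm : mdeg (odd_mnm m) = ((mdeg m).*2 + 5)%N.
  rewrite [LHS]mdegE [X in X.*2]mdegE -muln2 big_distrl /=.
  rewrite (eq_bigr (fun i => m i * 2 + 1)%N) => [|i _]; last first.
    by rewrite mnmE addn1 muln2.
  by rewrite big_split /= sum_nat_const card_ord muln1.
apply/eqP; apply: contraR nz => nem; apply/eqP/(dhomog_nemf_coeff hp).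
apply: contra nem => /eqP e; apply/eqP.
by have /addIn/double_inj := etrans (esym dm) e.
Qed.

Lemma homog_sqfree_sqr d p :
  p \is d.-homog -> sqfree (iota 0 5) * p ^+ 2 \is (d.*2 + 5).-homog.
Proof.
move=> hp; rewrite addnC; apply: dhomogM; last by rewrite -muln2; apply: dhomogMn.
by have := mono_homog (size_nseq 5 1); rewrite /mono /sqfree !big_cons !big_nil.
Qed.

(** Such an f induces an isomorphism from V / U to W / U'; here by rank-nullity on V and on U, which
    both contain the kernel. *)
Lemma dim_quotient_preim (F : fieldType) (V W : vectType F)
    (f : 'Hom(V, W)) (U : {vspace V}) (U' : {vspace W}) :
    (forall y, exists x, f x = y) -> (forall x, (x \in U) = (f x \in U')) ->
  (\dim {:V} - \dim U = \dim {:W} - \dim U')%N.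
Proof.
move=> surj memU.
have imU : (f @: U)%VS = U'.
  apply/vspaceP => y; have [x <-] := surj y; apply/memv_imgP/idP.
    by case=> z; rewrite memU => fz ->.
  by rewrite -memU; exists x.
have imV : (f @: fullv)%VS = fullv.
  apply/vspaceP => y; rewrite memvf; have [x <-] := surj y.
  by rewrite memv_img ?memvf.
have kerU : (lker f <= U)%VS.
  by apply/subvP => x; rewrite memv_ker memU => /eqP->; rewrite mem0v.
rewrite -(limg_ker_dim f U) -(limg_ker_dim f fullv) imU imV capfv.
by rewrite (capv_idPr kerU) subnDl.
Qed.

Section Kameko.
Variable d : nat.
Hypothesis low : forall ys, size ys = 5%N -> sumn ys = (d.*2 + 5)%N ->
  (size (odds ys) < 5)%N -> hit (mono ys).

(** By [low] the monomials killed by Kameko's map are hit, so y -> x_1 ... x_5 y^2 inverts the map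
    modulo hit polynomials. *)
Lemma hit_add_sqfree_kameko p : p \is (d.*2 + 5).-homog ->
  hit (p + sqfree (iota 0 5) * kameko d p ^+ 2).
Proof.
move=> hp; elim/homog_mono_ind: p / hp => [|p q hp hq|ys sz sys].
- by rewrite linear0 expr0n mulr0 addr0; apply: hit0.
- by rewrite linearD sqrPD mulrDr addrACA; apply: hitD.
have [lt5|ge5] := ltnP (size (odds ys)) 5.
  rewrite [in kameko _ _]mono_split // kameko_low ?filter_subseq //.
  by rewrite expr0n mulr0 addr0; apply: low.
have e5 : size (odds ys) = 5%N by apply/eqP; rewrite eqn_leq size_odds.
have hz := mono_homog (etrans (size_map half ys) sz).
rewrite [X in kameko _ X]mono_split // [X in X + _]mono_split // odds_full //.
rewrite (kameko_full _ hz); case: ifPn => [_|].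
  by rewrite addPP; apply: hit0.
by move: sys; rewrite sumn_split // e5; lia.
Qed.

(** It is enough to treat Sq^k y. Kameko's map sends the hit polynomial Sq^(2k) (x_1 ... x_5 y^2) to
    Sq^k y, so [hit_add_sqfree_kameko] makes x_1 ... x_5 (Sq^k y)^2 hit. *)
Lemma hit_sqfree_hit p : p \is d.-homog -> hit p ->
  hit (sqfree (iota 0 5) * p ^+ 2).
Proof.
move=> /pihomog_dE {2}<-.
apply: (hit_pihomog_rec (K := fun r => hit (sqfree (iota 0 5) * r ^+ 2))).
- by rewrite expr0n mulr0; apply: hit0.
- by move=> q r hq hr; rewrite sqrPD mulrDr; apply: hitD.
move=> k ys k_gt0 sz ed; have hS := Sq_homog k (mono_homog sz).
pose r := Sq k.*2 (sqfree (iota 0 5) * mono ys ^+ 2).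
have hr : r \is (d.*2 + 5).-homog.
  rewrite -ed doubleD -addnA [(k.*2 + 5)%N]addnC addnA.
  exact/Sq_homog/homog_sqfree_sqr/mono_homog.
have := hit_add_sqfree_kameko hr; rewrite [in kameko _ _]/r kameko_Sq //.
rewrite /Sqhalf subn0 odd_double doubleK /= (kameko_full _ hS) ed leqnn addrC.
by apply: hit_addr; apply: hit_Sq; rewrite double_gt0.
Qed.

Lemma dim_Q5 n : \dim {: Q5 n} = ('C(n + 4, n) - \dim (hit_vs 4 n))%N.
Proof. by rewrite dim_vquot dimvf. Qed.

Lemma dim_Q5_kameko :
  \dim {: Q5 (d.*2 + 5)} = \dim {: Q5 d}.
Proof.
set n := (d.*2 + 5)%N.
pose f0 (p : dhomog 5 'F_2 n) : dhomog 5 'F_2 d :=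
  DHomog (kameko_homog (dhomog_is_dhomog p)).
have f0lin : linear f0 by move=> a p q; apply: val_inj; rewrite /= linearP.
pose f := linfun (HB.pack_for {linear dhomog 5 'F_2 n -> dhomog 5 'F_2 d} f0
   (GRing.isLinear.Build _ _ _ _ f0 f0lin)).
have fE x : f x = f0 x by rewrite lfunE.
rewrite !dim_vquot; apply: (@dim_quotient_preim _ _ _ f).
  move=> y; exists (DHomog (homog_sqfree_sqr (dhomog_is_dhomog y)));
    apply: val_inj; rewrite fE /=.
  by rewrite (kameko_full _ (dhomog_is_dhomog y)) leqnn.
move=> x; apply/idP/idP => [/mem_hit_vs hx|].
  by apply/mem_hit_vs; rewrite fE; apply: hit_kameko.
move=> /mem_hit_vs; rewrite fE => hfx; apply/mem_hit_vs.
apply: hit_addr (hit_add_sqfree_kameko (dhomog_is_dhomog x)).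
by apply: hit_sqfree_hit hfx; apply/kameko_homog/dhomog_is_dhomog.
Qed.

End Kameko.

(** * Reduction to degree 41 *)

Lemma pow2_sum1_odd e : pow2_sum 1 e.*2.+1 -> e = 0%N.
Proof.
case/pow2_sum_half => z [f [lez ef]]; have -> : z = 1%N by lia.
by move/pow2_sum0 => f0; lia.
Qed.

(** Here 23 = 5 + 18, as n_s = 23 * 2^s - 5. The base value is 22 = 16 + 4 + 2. Passing from t to t
    + 1 doubles the number and adds 1; this forces a summand 1 and leaves one power fewer for the
    half. *)
Lemma not_pow2_sum_23 t :
  ~ pow2_sum 1 (23 * 2 ^ t - 1) /\ ~ pow2_sum 2 (23 * 2 ^ t - 1).
Proof.
elim: t => [|t [IH1 IH2]]; last first.
  have -> : (23 * 2 ^ t.+1 - 1 = (23 * 2 ^ t - 1).*2.+1)%N.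
    by have := expn_gt0 2 t; rewrite expnS; lia.
  split; first by move/pow2_sum1_odd; have := expn_gt0 2 t; lia.
  case/pow2_sum_half => z [f [lez ef]]; have -> : z = 1%N by lia.
  by have <- : (23 * 2 ^ t - 1 = f)%N by lia.
split; rewrite expn0 muln1 /=.
  case/pow2_sum_half => z [f [lez ef]]; have -> : z = 0%N by lia.
  by have -> : f = 5.*2.+1 by [lia]; move/pow2_sum1_odd.
case/pow2_sum_half => z [f [lez ef]].
have [z2|z0] : z = 2%N \/ z = 0%N by lia.
  by rewrite z2 => /pow2_sum0; lia.
rewrite z0; case/pow2_sum_half => y [g [ley eg]]; have -> : y = 1%N by lia.
by have -> : g = 2.*2.+1 by [lia]; move/pow2_sum1_odd.
Qed.

Lemma dim_Q5_41 s : (0 < s)%N ->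
  \dim {: Q5 (5 * (2 ^ s - 1) + 18 * 2 ^ s)} = \dim {: Q5 41}.
Proof.
case: s => [s0|s _]; first discriminate s0.
elim: s => [|s <-].
  by rewrite (_ : 5 * (2 ^ 1 - 1) + 18 * 2 ^ 1 = 41)%N.
have -> : (5 * (2 ^ s.+2 - 1) + 18 * 2 ^ s.+2 =
    (5 * (2 ^ s.+1 - 1) + 18 * 2 ^ s.+1).*2 + 5)%N.
  by have := expn_gt0 2 s.+1; rewrite (expnS _ s.+1); lia.
apply: dim_Q5_kameko => ys sz sys lt5; apply: hit_mono => //.
have := sumn_split sz; rewrite sys; move: lt5 (sumn _) => + e.
have := not_pow2_sum_23 s; have := expn_gt0 2 s; rewrite expnS.
move: (2 ^ s)%N => m m_gt0 [no1 no2].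
move: (size _) => j ltj ej.
(* The degree is odd, hence so is |S|. Removing the summands 1 from |S| + deg y and halving gives 23
   * 2^s - 1 with at most two powers left, except when all three summands are 1: then the half would
   have to be 0. *)
have [j1|j3] : j = 1%N \/ j = 3%N by lia.
  rewrite j1; case/pow2_sum_half => z [f [lez ef]].
  have -> : z = 0%N by lia.
  by have <- : (23 * m - 1 = f)%N by lia.
rewrite j3; case/pow2_sum_half => z [f [lez ef]].
have [z1|z3] : z = 1%N \/ z = 3%N by lia.
  by rewrite z1; have <- : (23 * m - 1 = f)%N by lia.
by rewrite z3 => /pow2_sum0; lia.
Qed.

(** * Hit polynomials of degree 41 *)

Lemma size_splits s ut :
  ut \in splits s -> (size ut.1 + size ut.2)%N = size s.
Proof.
elim: s ut => [|i s IHs] ut /=; first by rewrite inE => /eqP->.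
by rewrite mem_cat => /orP[] /mapP[x /IHs <- ->] //=; rewrite addnS.
Qed.

Lemma sqfree_homog s : sqfree s \is (size s).-homog.
Proof.
elim: s => [|i s IHs]; first by rewrite /sqfree big_nil dhomog1.
by rewrite /sqfree big_cons /=; apply: (dhomogM (X_homog i) IHs).
Qed.

Definition pairs : seq (nat * nat) :=
  [:: (0, 1); (0, 2); (0, 3); (0, 4); (1, 2); (1, 3); (1, 4); (2, 3); (2, 4);
      (3, 4)]%N.

Definition compl (t : seq nat) : seq nat := [seq i <- iota 0 5 | i \notin t].

(** Here t lists the variables of even exponent: none, one or two of them for |S| = 5, 4, 3. *)
Definition part (t : seq nat) p : P := sqfree (compl t) * p ^+ 2.

(* Sq^1 (part [:: j] u) for f = X^~ * u. *)
Definition B_elt (j : nat) (f : nat -> P) : P :=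
  \sum_(i <- compl [:: j]) part [:: i; j] (f i).

(* Sq^2 (part [::] u). *)
Definition C_elt u : P :=
  part [::] (Sq 1 u) +
  \sum_(ik <- pairs) part [:: ik.1; ik.2] (X ik.1 * (X ik.2 * u)).

Lemma partD t p q : part t (p + q) = part t p + part t q.
Proof. by rewrite /part sqrPD mulrDr. Qed.

Lemma part0 t : part t 0 = 0.
Proof. by rewrite /part expr0n mulr0. Qed.

Lemma part_sym i k p : part [:: i; k] p = part [:: k; i] p.
Proof.
rewrite /part; congr (sqfree _ * _); apply: eq_filter => j.
by rewrite !inE orbC.
Qed.

Lemma B_eltD j f g : B_elt j (fun i => f i + g i) = B_elt j f + B_elt j g.
Proof. by rewrite /B_elt -big_split; apply: eq_bigr => i _; apply: partD. Qed.

Lemma C_eltD u v : C_elt (u + v) = C_elt u + C_elt v.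
Proof.
rewrite /C_elt SqD partD addrACA -big_split; congr (_ + _).
by apply: eq_bigr => ik _; rewrite !mulrDr partD.
Qed.

Lemma sum_offdiag (F : nat -> nat -> P) :
  \sum_(j <- iota 0 5) \sum_(i <- compl [:: j]) F i j =
  \sum_(ik <- pairs) (F ik.1 ik.2 + F ik.2 ik.1).
Proof. rewrite !big_cons !big_nil /=; ring. Qed.

Lemma splits_compl2 ik : ik \in pairs ->
  let s := compl [:: ik.1; ik.2] in
  [seq ut <- splits s | (2 < size ut.1)%N && (odd (size ut.2) == false)] =
  [:: (s, [::])].
Proof.
move=> pik; apply/eqP; move: ik pik; apply/allP.
by [].
Qed.

Lemma splits_compl1 j : (j < 5)%N ->
  let s := compl [:: j] in
  [seq ut <- splits s | (2 < size ut.1)%N && (odd (size ut.2) == true)] =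
  [seq (compl [:: i; j], [:: i]) | i <- s].
Proof. by case: j => [|[|[|[|[|]]]]]. Qed.

Lemma splits_compl0 :
  let s := iota 0 5 in
  [seq ut <- splits s | (2 < size ut.1)%N && (odd (size ut.2) == false)] =
  rcons [seq (compl [:: ik.1; ik.2], [:: ik.1; ik.2]) | ik <- pairs] (s, [::]).
Proof. by []. Qed.

Lemma odds_cases ys : let s := odds ys in
  [\/ (size s <= 2%N)%N, exists2 ik, ik \in pairs & s = compl [:: ik.1; ik.2],
      exists2 j, (j < 5)%N & s = compl [:: j] | s = iota 0 5].
Proof.
have {ys} [a [b [c [d [e ->]]]]] : exists a b c d e, odds ys =
    mask [:: a; b; c; d; e] (iota 0 5).
  by do 5!eexists; rewrite /odds filter_mask /=.
case: a; case: b; case: c; case: d; case: e => /=;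
  try by [constructor 1 | constructor 4].
all: try by [constructor 3; exists 0%N | constructor 3; exists 1%N |
  constructor 3; exists 2%N | constructor 3; exists 3 | constructor 3; exists 4].
all: constructor 2; try by [exists (0, 1)%N | exists (0, 2)%N | exists (0, 3)%N |
  exists (0, 4)%N | exists (1, 2)%N | exists (1, 3)%N | exists (1, 4)%N |
  exists (2, 3)%N | exists (2, 4)%N | exists (3, 4)%N].
Qed.

(** The terms of [Sq_sqfree_sqr] with at least three odd exponents; in degree 41 the others are hit.
    The parity condition discards terms whose [Sqhalf] is 0. *)
Definition Sq_main k s w : P :=
  \sum_(ut <- splits s | (2 < size ut.1)%N && (odd (size ut.2) == odd k))
     sqfree ut.1 * (sqfree ut.2 * Sqhalf k (size ut.2) w) ^+ 2.

Lemma Sq_main2 ik h w : ik \in pairs ->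
  Sq_main h.*2 (compl [:: ik.1; ik.2]) w = part [:: ik.1; ik.2] (Sq h w).
Proof.
move=> pik; rewrite /Sq_main odd_double -big_filter splits_compl2 // big_seq1 /=.
by rewrite /Sqhalf /= subn0 odd_double doubleK [sqfree [::]]big_nil mul1r.
Qed.

Lemma Sq_main1 j h w : (j < 5)%N ->
  Sq_main h.*2.+1 (compl [:: j]) w = B_elt j (fun i => X i * Sq h w).
Proof.
move=> ltj; rewrite /Sq_main /= odd_double -big_filter splits_compl1 //.
rewrite big_map; apply: eq_bigr => i _.
by rewrite /Sqhalf /= subSS subn0 odd_double doubleK [sqfree [:: _]]big_seq1.
Qed.

Lemma Sq_main0 h w : Sq_main h.+1.*2 (iota 0 5) w = part [::] (Sq h.+1 w) +
  \sum_(ik <- pairs) part [:: ik.1; ik.2] (X ik.1 * (X ik.2 * Sq h w)).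
Proof.
rewrite /Sq_main odd_double -big_filter splits_compl0 -cats1 big_cat big_seq1.
rewrite big_map /= /Sqhalf doubleS !subSS !subn0 /= odd_double !doubleK /=.
rewrite [sqfree [::]]big_nil mul1r addrC; congr (_ + _).
by apply: eq_bigr => ik _; rewrite [sqfree [:: _; _]]big_cons big_seq1 -mulrA.
Qed.

(** * Generators of the hit polynomials *)

Section Generators.
Variable K : P -> Prop.
Hypothesis K0 : K 0.
Hypothesis KD : forall p q, K p -> K q -> K (p + q).
Hypothesis Klow : forall s d v, (size s <= 2%N)%N -> v \is d.-homog ->
  (size s + d.*2)%N = 41%N -> K (sqfree s * v ^+ 2).

Lemma K_addr p q : K q -> K (p + q) -> K p.
Proof. by move=> hq hpq; rewrite -[p](addPK p q); apply: KD. Qed.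

Lemma K_sum (I : Type) (s : seq I) (Q : pred I) (F : I -> P) :
  (forall i, Q i -> K (F i)) -> K (\sum_(i <- s | Q i) F i).
Proof. exact: (big_ind K K0 KD). Qed.

(** K is any additively closed predicate: with [hit] this shows that the generators are hit, with
    [inspan rows] that the rows span. *)
Lemma K_Sq_main k s w e : w \is e.-homog -> (size s + e.*2 + k)%N = 41%N ->
  K (Sq k (sqfree s * w ^+ 2) + Sq_main k s w).
Proof.
move=> hw en; rewrite Sq_sqfree_sqr /Sq_main.
rewrite (bigID (fun ut => (2 < size ut.1)%N && (odd (size ut.2) == odd k))) /=.
rewrite [X in X + _]addrC addPK big_seq_cond.
apply: (big_ind K K0 KD) => -[u t] /andP[/= /size_splits/= szut].
rewrite /Sqhalf; case: ifP => [/andP[lek ev]|_ _]; last first.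
  by rewrite mulr0 expr0n mulr0.
have -> : odd (size t) == odd k by rewrite oddB // in ev; case: odd ev; case: odd.
rewrite andbT -leqNgt => szu; apply: (Klow szu).
  exact: dhomogM (sqfree_homog t) (Sq_homog _ hw).
move: (odd_double_half (k - size t)) en szut lek; rewrite (negPf ev) /=; lia.
Qed.

Section Upper.
Hypothesis Kpair : forall ik k v, ik \in pairs -> (0 < k)%N -> (k <= 19)%N ->
  v \is (19 - k).-homog -> K (part [:: ik.1; ik.2] (Sq k v)).
Hypothesis Keven : forall k v, (0 < k)%N -> ~~ odd k -> (k <= 18)%N ->
  v \is (18 - k).-homog -> K (part [::] (Sq k v)).

Lemma compl_pair j i : (j < 5)%N -> i \in compl [:: j] ->
  exists2 ik, ik \in pairs & forall p, part [:: i; j] p = part [:: ik.1; ik.2] p.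
Proof.
rewrite mem_filter inE mem_iota /= => ltj5 /andP[nij lti5].
have [ltij|lej] := ltnP i j.
  exists (i, j) => //.
  by move: i j ltij ltj5 {nij lti5} => [|[|[|[|[|?]]]]] [|[|[|[|[|?]]]]].
exists (j, i) => [|p]; last exact: part_sym.
by move: i j lej nij lti5 {ltj5} => [|[|[|[|[|?]]]]] [|[|[|[|[|?]]]]].
Qed.

Lemma K_B_Sq j k (f : nat -> P) : (j < 5)%N -> (0 < k)%N -> (k <= 19)%N ->
  (forall i, f i \is (19 - k).-homog) -> K (B_elt j (fun i => Sq k (f i))).
Proof.
move=> ltj k_gt0 lek hf; rewrite /B_elt big_seq; apply: K_sum => i.
by case/(compl_pair ltj) => ik pik ->; apply: Kpair.
Qed.

(* X_i Sq^k v = Sq^k (X_i v) + X_i^2 Sq^(k-1) v, and likewise with Sq^(k-1) v in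
   place of v and 1 in place of k; but Sq^1 Sq^(k-1) v = 0 for k even. *)
Lemma K_B_even j k v : (j < 5)%N -> (0 < k)%N -> ~~ odd k -> (k <= 18)%N ->
  v \is (18 - k).-homog -> K (B_elt j (fun i => X i * Sq k v)).
Proof.
case: k => // k ltj _ evk lek hv.
have hX d i w : w \is d.-homog -> X i * w \is d.+1.-homog.
  by move=> hw; apply: (dhomogM (X_homog i) hw).
have K1 : K (B_elt j (fun i => Sq 1 (X i * Sq k v))).
  apply: K_B_Sq => // i; apply: (hX 17%N).
  by have := Sq_homog k hv; rewrite subSS subnK.
apply: (K_addr K1).
rewrite -B_eltD.
have -> : B_elt j (fun i => X i * Sq k.+1 v + Sq 1 (X i * Sq k v)) =
    B_elt j (fun i => Sq k.+1 (X i * v)).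
  apply: eq_bigr => i _; rewrite !Sq_mulX Sq0 Sq1Sq.
  by move: evk => /= /negbNE->; rewrite mulr0 add0r.
apply: (@K_B_Sq j k.+1 (fun i => X i * v)) => // [|i]; first exact: leqW.
by have := hX _ i v hv; rewrite -subSn.
Qed.

Hypothesis KB : forall j u, (j < 5)%N -> u \is 18.-homog ->
  K (B_elt j (fun i => X i * u)).

(** In each pair component the elements [b j] contribute X_i X_k^2 v + X_k X_i^2 v, which completes
    X_i X_k Sq^1 v to Sq^1 (X_i X_k v). The component |S| = 5 is 0 because Sq^1 Sq^1 = 0. *)
Lemma K_C_Sq1 v : v \is 16.-homog -> K (C_elt (Sq 1 v)).
Proof.
move=> hv; rewrite /C_elt Sq1Sq part0 add0r.
pose b j := B_elt j (fun i => X i * (X j ^+ 2 * v)).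
apply: (@K_addr _ (\sum_(j <- iota 0 5) b j)).
  rewrite big_seq; apply: K_sum => j; rewrite mem_iota => ltj; apply: KB => //.
  exact: (dhomogM (dhomogMn 2 (X_homog j)) hv).
rewrite /b /B_elt sum_offdiag -big_split big_seq; apply: K_sum => -[i k] pik /=.
rewrite [X in _ + (_ + X)]part_sym -!partD.
have -> : X i * (X k * Sq 1 v) + (X i * (X k ^+ 2 * v) + X k * (X i ^+ 2 * v)) =
    Sq 1 (X i * (X k * v)).
  rewrite !Sq_mulX !Sq0 mulrDr -addrA; congr (_ + (_ + _)).
  by rewrite !expr2 -!mulrA [LHS]mulrCA; congr (_ * _); rewrite mulrCA.
apply: (Kpair (ik := (i, k))) => //.
exact: (dhomogM (X_homog i) (dhomogM (X_homog k) hv)).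
Qed.

(* This is Sq^1 Sq^1 = 0. *)
Lemma sum_B_elt u :
  \sum_(j <- iota 0 5) B_elt j (fun i => X i * (X j * u)) = 0.
Proof.
rewrite /B_elt sum_offdiag big1 // => ik _.
by rewrite [in X in _ + X]mulrCA [X in _ + X]part_sym addPP.
Qed.

Hypothesis KC : forall u, u \is 17.-homog -> K (C_elt u).

Lemma K_Sq_monomial k ys : (0 < k)%N -> size ys = 5%N ->
  (sumn ys + k)%N = 41%N -> K (Sq k (mono ys)).
Proof.
move=> k_gt0 sz; rewrite sumn_split // mono_split // => dk.
have hw := mono_homog (etrans (size_map half ys) sz).
set w := mono _ in hw *; set e := sumn _ in hw dk.
suff Kmain : K (Sq_main k (odds ys) w) by apply: K_addr Kmain (K_Sq_main hw dk).
have [szs|[ik pik s_]|[j ltj s_]|s_] := odds_cases ys.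
- rewrite /Sq_main big_seq_cond big1 // => ut /and3P[/size_splits szut lt2 _].
  by move: szs; rewrite leqNgt -szut (leq_trans lt2) ?leq_addr.
- have sz3 : size (odds ys) = 3%N.
    by rewrite s_; apply/eqP; move: ik pik {s_}; apply/allP.
  have [h [ek h_gt0]] : exists h, k = h.*2 /\ (0 < h)%N by exists k./2; lia.
  rewrite s_ ek Sq_main2 //; apply: Kpair => //; first by lia.
  by have <- : (e = 19 - h)%N by lia.
- have sz4 : size (odds ys) = 4%N by rewrite s_;
    case: j ltj {s_} => [|[|[|[|[|]]]]].
  have [h ek] : exists h, k = h.*2.+1 by exists k./2; lia.
  rewrite s_ ek Sq_main1 //; apply: KB => //.
  by have -> : (18 = e + h)%N by [lia]; apply: Sq_homog.
have sz5 : size (odds ys) = 5%N by rewrite s_.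
have [h ek] : exists h, k = h.+1.*2 by exists k./2.-1; lia.
have hu : Sq h w \is 17.-homog.
  by have -> : (17 = e + h)%N by [lia]; apply: Sq_homog.
(* The pair components of [C_elt (Sq h w)] are the same. What is left is Sq^(h+1) w + Sq^1 Sq^h w in
   the component |S| = 5: this is 0 for h even, and Sq^(h+1) w, with h + 1 even, for h odd. *)
rewrite s_ ek Sq_main0; apply: (K_addr (KC hu)).
rewrite /C_elt [X in _ + X]addrC addrA addPK Sq1Sq.
case: ifP => [odh|_]; last by rewrite addPP.
rewrite part0 addr0; apply: Keven; rewrite //= ?odh //; first by lia.
by have <- : (e = 18 - h.+1)%N by lia.
Qed.

Lemma K_pihomog_hit p : hit p -> K (pihomog mdeg 41 p).
Proof. by apply: hit_pihomog_rec K0 KD K_Sq_monomial p. Qed.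

End Upper.
End Generators.

(** By parity |s| = 1 and d = 20, and 21 is not a power of 2. *)
Lemma hit_low s d v : (size s <= 2%N)%N -> v \is d.-homog ->
  (size s + d.*2)%N = 41%N -> hit (sqfree s * v ^+ 2).
Proof.
move=> szs hv e41; apply: (hit_sqfree_sqr hv).
have -> : (size s + d = 10.*2.+1)%N by lia.
have -> : size s = 1%N by lia.
by move/pow2_sum1_odd.
Qed.

Lemma hit_Sq_main k s w e : w \is e.-homog -> (size s + e.*2 + k)%N = 41%N ->
  (0 < k)%N -> hit (Sq_main k s w).
Proof.
move=> hw e41 k_gt0; have := K_Sq_main (@hit0 5) (@hitD 5) hit_low hw e41.
by rewrite addrC; apply/hit_addr/hit_Sq.
Qed.

Lemma hit_part2 ik k v : ik \in pairs -> (0 < k)%N -> (k <= 19)%N ->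
  v \is (19 - k).-homog -> hit (part [:: ik.1; ik.2] (Sq k v)).
Proof.
move=> pik k_gt0 lek hv; rewrite -Sq_main2 //; apply: (hit_Sq_main hv).
  have -> : size (compl [:: ik.1; ik.2]) = 3%N.
    by apply/eqP; move: ik pik; apply/allP.
  by lia.
by rewrite double_gt0.
Qed.

Lemma hit_B_elt j u : (j < 5)%N -> u \is 18.-homog ->
  hit (B_elt j (fun i => X i * u)).
Proof.
move=> ltj hu; have := Sq_main1 0 u ltj; rewrite Sq0 => <-.
by apply: (hit_Sq_main hu) => //; case: j ltj => [|[|[|[|[|]]]]].
Qed.

Lemma hit_C_elt u : u \is 17.-homog -> hit (C_elt u).
Proof.
move=> hu; have <- : Sq_main 2 (iota 0 5) u = C_elt u.
  by rewrite (Sq_main0 0) Sq0.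
exact: (hit_Sq_main hu).
Qed.

(** As k - 1 is odd, Sq^1 Sq^(k-1) v = 0, so that [C_elt] of Sq^(k-1) v consists of its pair terms
    alone. These are also the pair terms of the hit polynomial given by [Sq_main0], whose remaining
    term is the one wanted. *)
Lemma hit_part0 k v : (0 < k)%N -> ~~ odd k -> (k <= 18)%N ->
  v \is (18 - k).-homog -> hit (part [::] (Sq k v)).
Proof.
case: k => // k _ evk lek hv.
have hs : Sq k v \is 17.-homog.
  by have -> : (17 = 18 - k.+1 + k)%N by [lia]; apply: Sq_homog.
have := hit_C_elt hs; rewrite /C_elt Sq1Sq ifT; last by move: evk; rewrite /= negbK.
rewrite part0 add0r => hp; apply: (hit_addr hp).
by rewrite -Sq_main0; apply: (hit_Sq_main hv); rewrite /=; lia.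
Qed.

(** * Gaussian elimination *)

(* Polynomials over F_2 as sets of monomials: Node l r stands for x l + r, where
   x is the current variable and r only involves the later ones. In a
   homogeneous polynomial of degree d the exponent of the last variable is
   determined by the others, so that One stands for a power of it. *)
Inductive hpoly := Zero | One | Node of hpoly & hpoly.

Fixpoint heqb g h := match g, h with
  | Zero, Zero | One, One => true
  | Node l r, Node l' r' => heqb l l' && heqb r r'
  | _, _ => false
  end.

Lemma heqP : Equality.axiom heqb.
Proof.
elim=> [||l IHl r IHr] [||l' r'] /=; try by constructor.
by apply: (iffP andP) => [[/IHl-> /IHr->]|[<- <-]] //; split; [apply/IHl|apply/IHr].
Qed.
HB.instance Definition _ := hasDecEq.Build hpoly heqP.

Definition hnode l r := match l, r with Zero, Zero => Zero | _, _ => Node l r end.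

(** At every level [One] evaluates to a power of the last variable; adding it along the right spine
    makes [heval_hadd] true of ill-formed trees as well. *)
Fixpoint hadd1 h :=
  match h with Zero => One | One => Zero | Node l r => Node l (hadd1 r) end.

Fixpoint hadd g h {struct g} := match g with
  | Zero => h
  | One => hadd1 h
  | Node l r => match h with
    | Zero => g
    | One => hadd1 g
    | Node l' r' => hnode (hadd l l') (hadd r r')
    end
  end.

(** On reduced trees this is the lexicographically largest monomial: a nonzero left subtree means a
    higher power of the current variable. *)
Fixpoint hlead g := match g with
  | Node Zero r => Node Zero (hlead r)
  | Node l r => Node (hlead l) Zero
  | _ => g
  end.

Fixpoint heval (i d : nat) (g : hpoly) : P := match g with
  | Zero => 0
  | One => X 4 ^+ d
  | Node l r => X i * heval i d.-1 l + heval i.+1 d r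
  end.

(** [n] counts the variables before the last one. In degree 0 the left subtree must be [Zero], since
    there [heval] truncates d - 1 to 0. *)
Fixpoint hwf (n d : nat) (g : hpoly) : bool := match g with
  | Zero => true
  | One => n == 0%N
  | Node l r => if n is n'.+1 then
      (if d is d'.+1 then hwf n d' l else l == Zero) && hwf n' d r else false
  end.

Lemma heval_hnode i d l r : heval i d (hnode l r) = heval i d (Node l r).
Proof. by case: l r => [||? ?] [||? ?] //=; rewrite mulr0 addr0. Qed.

Lemma heval_hadd1 i d h : heval i d (hadd1 h) = X 4 ^+ d + heval i d h.
Proof.
elim: h i d => [||l _ r IHr] i d /=; first by rewrite addr0.
  by rewrite addPP.
by rewrite IHr addrCA.
Qed.

Lemma heval_hadd i d g h : heval i d (hadd g h) = heval i d g + heval i d h.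
Proof.
elim: g i d h => [||l IHl r IHr] i d h; first by rewrite add0r.
  exact: heval_hadd1.
case: h => [||l' r']; first by rewrite addr0.
  by rewrite addrC; apply: (heval_hadd1 i d (Node l r)).
by rewrite heval_hnode /= IHl IHr mulrDr addrACA.
Qed.

Lemma hwf_hnode n d l r : hwf n d (Node l r) -> hwf n d (hnode l r).
Proof. by case: l r => [||? ?] [||? ?]. Qed.

Lemma hwf_hadd n d g h : hwf n d g -> hwf n d h -> hwf n d (hadd g h).
Proof.
elim: g n d h => [||l IHl r IHr] n d h //; first by case: n h => [|n] [||l r].
case: h => [||l' r']; case: n => [|n] //= /andP[wl wr] /andP[wl' wr'].
apply: hwf_hnode => /=; rewrite IHr // andbT.
by case: d wl wl' {wr wr'} => [/eqP-> /eqP->|d] //; apply: IHl.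
Qed.

Fixpoint hshift (a : nat) h :=
  if a is a'.+1 then Node (hshift a' h) Zero else Node Zero h.

Fixpoint hmono ys := if ys is a :: ys' then
  if ys' is [::] then One else hshift a (hmono ys') else One.

Lemma heval_hshift i d a h :
  heval i d (hshift a h) = X i ^+ a * heval i.+1 (d - a) h.
Proof.
elim: a d => [|a IHa] d /=; first by rewrite mulr0 add0r mul1r subn0.
by rewrite IHa addr0 exprS mulrA -subn1 subnAC subn1 subnS.
Qed.

Lemma hwf_hshift n d a h : hwf n d h -> hwf n.+1 (a + d) (hshift a h).
Proof. by elim: a => [|a IHa] //= wh; rewrite ?IHa // wh; case: (d). Qed.

Fixpoint gmono i ys : P := if ys is a :: ys' then
  if ys' is [::] then X 4 ^+ a else X i ^+ a * gmono i.+1 ys' else 1.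

Lemma gmonoE ys : size ys = 5%N -> gmono 0 ys = mono ys.
Proof.
case: ys => [|a [|b [|c [|d [|e [|]]]]]] //= _.
by rewrite /mono !big_cons big_nil mulr1.
Qed.

Lemma heval_hmono i ys :
  (0 < size ys)%N -> heval i (sumn ys) (hmono ys) = gmono i ys.
Proof.
elim: ys i => [|a [|b ys] IHys] i // _; first by rewrite /= addn0.
rewrite [hmono _]/(hshift a (hmono (b :: ys))) heval_hshift.
by rewrite [sumn _]/(a + sumn (b :: ys))%N addKn IHys.
Qed.

Lemma hwf_hmono ys : (0 < size ys)%N -> hwf (size ys).-1 (sumn ys) (hmono ys).
Proof.
elim: ys => [|a [|b ys] IHys] // _.
exact: hwf_hshift (IHys isT).
Qed.

(** * Row reduction with a table indexed by leading monomials *)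

Inductive table := TNil | TLeaf of hpoly | TNode of table & table.

(** A table is a trie whose paths are monomials. The lookup follows the leading monomial of g
    without building it; [Zero] means that no row is stored there. *)
Fixpoint hfind t g := match g, t with
  | One, TLeaf h => h
  | Node l r, TNode tl tr => if l is Zero then hfind tr r else hfind tl l
  | _, _ => Zero
  end.

Fixpoint hstore h t g {struct g} := match g with
  | Zero => t
  | One => TLeaf h
  | Node l r =>
    let: (tl, tr) := if t is TNode tl tr then (tl, tr) else (TNil, TNil) in
    if l is Zero then TNode tl (hstore h tr r) else TNode (hstore h tl l) tr
  end.

(* The constant true; under lazy evaluation it normalizes its argument, which
   keeps the thunks stored in a table small. *)
Fixpoint hforce h :=
  if h is Node l r then if hforce l then hforce r else false else true.

Fixpoint hinsert fuel st h : option (table * seq hpoly) :=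
  if fuel isn't fuel'.+1 then None else
  match h with
  | Zero => Some st
  | _ => match hfind st.1 h with
    | Zero => if hforce h then Some (hstore h st.1 h, h :: st.2) else None
    | g => hinsert fuel' st (hadd h g)
    end
  end.

(* Gaussian elimination: the rows found, together with a table giving them by
   leading monomial. *)
Definition helim fuel (s : seq hpoly) : option (table * seq hpoly) :=
  foldl (fun o h => if o is Some st then hinsert fuel st h else None)
    (Some (TNil, [::])) s.

(** g collects the monomials that lead no row. When the fuel runs out, the result is still congruent
    to g + h modulo the rows, so that [hnf_span] holds for any fuel. *)
Fixpoint hnf fuel t h g := if fuel isn't fuel'.+1 then hadd g h else
  match h with
  | Zero => g
  | _ => match hfind t h with
    | Zero => let m := hlead h in hnf fuel' t (hadd h m) (hadd g m)
    | f => hnf fuel' t (hadd h f) g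
    end
  end.

(* The values of f at the monomials of degree d in n + 1 variables. *)
Fixpoint htab (f : hpoly -> hpoly) n d (c : hpoly -> hpoly) {struct n} :=
  if n isn't n'.+1 then TLeaf (f (c One)) else
  (fix tab d (c : hpoly -> hpoly) {struct d} := TNode
     (if d is d'.+1 then tab d' (fun h => c (Node h Zero)) else TNil)
     (htab f n' d (fun h => c (Node Zero h)))) d c.

Fixpoint happ t h := match h, t with
  | One, TLeaf g => g
  | Node l r, TNode tl tr => hadd (happ tl l) (happ tr r)
  | _, _ => Zero
  end.

(** The context c records the path from the root, so that each row is required to be stored at its
    own leading monomial. *)
Fixpoint tok (Q : hpoly -> Prop) (c : hpoly -> hpoly) t : Prop := match t with
  | TNil => True
  | TLeaf h => Q h /\ hlead h = c One
  | TNode tl tr =>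
    tok Q (fun h => c (Node h Zero)) tl /\ tok Q (fun h => c (Node Zero h)) tr
  end.

Lemma hlead_eq0 h : (hlead h == Zero) = (h == Zero).
Proof. by case: h => [||[||? ?] ?]. Qed.

Lemma tok_hfind (Q : hpoly -> Prop) c t g : tok Q c t ->
  hfind t g = Zero \/ Q (hfind t g) /\ hlead (hfind t g) = c (hlead g).
Proof.
elim: g c t => [||l IHl r IHr] c [|h|tl tr] //=; auto.
case=> tokl tokr; case: l IHl => [||l1 l2] IHl.
- exact: (IHr _ _ tokr).
- exact: (IHl _ _ tokl).
- exact: (IHl _ _ tokl).
Qed.

Lemma tok_hstore (Q : hpoly -> Prop) c t g h : tok Q c t -> Q h ->
  hlead h = c (hlead g) -> tok Q c (hstore h t g).
Proof.
elim: g c t => [||l IHl r IHr] c t tokt Qh //= hg.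
have [tl [tr [-> [tokl tokr]]]] : exists tl tr,
    (if t is TNode tl tr then (tl, tr) else (TNil, TNil)) = (tl, tr) /\
    tok Q (fun h => c (Node h Zero)) tl /\ tok Q (fun h => c (Node Zero h)) tr.
  by case: t tokt => [|g|tl tr] /= tokt; do 2!eexists; split; try by [].
by case: l IHl hg => [||l1 l2] IHl hg; split=> //; [apply: IHr|apply: IHl..].
Qed.

Lemma hinsertS fuel st h : hinsert fuel.+1 st h =
  if h == Zero then Some st else if hfind st.1 h == Zero then
    Some (hstore h st.1 h, h :: st.2)
  else hinsert fuel st (hadd h (hfind st.1 h)).
Proof.
have force g : hforce g by elim: g => //= l -> r ->.
by case: h => [||l r] //=; rewrite ?force; case: hfind.
Qed.

Lemma hnfS fuel t h g : hnf fuel.+1 t h g =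
  if h == Zero then g else if hfind t h == Zero then
    hnf fuel t (hadd h (hlead h)) (hadd g (hlead h))
  else hnf fuel t (hadd h (hfind t h)) g.
Proof. by case: h => [||l r] //=; case: hfind. Qed.

Lemma hinsert_closed (Q : hpoly -> Prop) fuel st h st' :
    (forall g h, Q g -> Q h -> Q (hadd g h)) ->
    tok Q id st.1 -> {in st.2, forall g, Q g} -> Q h ->
    hinsert fuel st h = Some st' ->
  tok Q id st'.1 /\ {in st'.2, forall g, Q g}.
Proof.
move=> QD tokQ Qrows; elim: fuel h => // fuel IHfuel h Qh; rewrite hinsertS.
case: eqP => [_ [<-] //|_]; case: eqP => [_ [<-]|nf].
  split=> [|g]; first exact: tok_hstore.
  by rewrite inE => /predU1P[->|/Qrows].
by have [|[Qf _]] := tok_hfind h tokQ; [|apply/IHfuel/QD].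
Qed.

Lemma hinsert_sub fuel st h st' :
  hinsert fuel st h = Some st' -> {subset st.2 <= st'.2}.
Proof.
elim: fuel h => // fuel IHfuel h; rewrite hinsertS.
case: eqP => [_ [<-] //|_]; case: eqP => [_ [<-] g gs|_ /IHfuel//].
by rewrite inE gs orbT.
Qed.

Lemma helim_rcons fuel s h st : helim fuel (rcons s h) = Some st ->
  exists2 st0, helim fuel s = Some st0 & hinsert fuel st0 h = Some st.
Proof. by rewrite /helim foldl_rcons; case: foldl => // st0; exists st0. Qed.

(** Rows are sums of inputs, hence inherit additive properties from them. [helim_span] is the
    converse. *)
Lemma helim_closed (Q : hpoly -> Prop) fuel s st :
    (forall g h, Q g -> Q h -> Q (hadd g h)) -> {in s, forall h, Q h} ->
    helim fuel s = Some st ->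
  tok Q id st.1 /\ {in st.2, forall g, Q g}.
Proof.
move=> QD; elim/last_ind: s st => [|s h IHs] st; first by move=> _ [<-].
move=> Qs /helim_rcons[st0 E0 E].
have [|tok0 Q0] := IHs _ _ E0.
  by move=> g gs; apply: Qs; rewrite mem_rcons inE gs orbT.
by apply: hinsert_closed E => //; apply: Qs; rewrite mem_rcons mem_head.
Qed.

Section Span.
Variables (K : P -> Prop) (phi : hpoly -> P).
Hypothesis K0 : K 0.
Hypothesis KD : forall p q, K p -> K q -> K (p + q).
Hypothesis phi0 : phi Zero = 0.
Hypothesis phiD : forall g h, phi (hadd g h) = phi g + phi h.

Lemma hinsert_span fuel st h st' :
    hinsert fuel st h = Some st' -> tok (K \o phi) id st.1 ->
    {in st'.2, forall g, K (phi g)} ->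
  tok (K \o phi) id st'.1 /\ K (phi h).
Proof.
elim: fuel h => // fuel IHfuel h; rewrite hinsertS.
case: eqP => [-> [<-]|_]; first by rewrite phi0.
case: eqP => [_ [<-] tokK Krows|nf E tokK Krows].
  have Kh : K (phi h) by apply: Krows; rewrite mem_head.
  by split=> //; apply: tok_hstore.
have [/nf//|[Kf _]] := tok_hfind h tokK.
have [tokK' Kadd] := IHfuel _ E tokK Krows; split=> //.
by apply: (K_addr KD Kf); rewrite -phiD.
Qed.

(** Each input was brought to zero or to a new row by adding stored rows, and rows are never
    removed, so that it is a sum of final rows. *)
Lemma helim_span fuel s st :
    helim fuel s = Some st -> {in st.2, forall g, K (phi g)} ->
  tok (K \o phi) id st.1 /\ {in s, forall h, K (phi h)}.
Proof.
elim/last_ind: s st => [|s h IHs] st; first by case=> <-.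
case/helim_rcons=> st0 /IHs{}IHs E Krows.
have [|tok0 Ks] := IHs; first by move=> g /(hinsert_sub E)/Krows.
have [tokK Kh] := hinsert_span E tok0 Krows; split=> // g.
by rewrite mem_rcons inE => /predU1P[->|/Ks].
Qed.

Lemma hnf_span fuel t h g : tok (K \o phi) id t ->
  K (phi (hnf fuel t h g) + (phi g + phi h)).
Proof.
move=> tokK; elim: fuel h g => [|fuel IHfuel] h g.
  by rewrite /= phiD addPP.
rewrite hnfS; case: eqP => [->|_]; first by rewrite phi0 addr0 addPP.
case: eqP => [_|nf].
  have := IHfuel (hadd h (hlead h)) (hadd g (hlead h)); rewrite !phiD.
  by congr (K (_ + _)); rewrite addrACA addPP addr0.
have [/nf//|[Kf _]] := tok_hfind h tokK.
apply: (K_addr KD Kf).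
by have := IHfuel (hadd h (hfind t h)) g; rewrite phiD !addrA.
Qed.

End Span.

Lemma hwf_hlead n d h : hwf n d h -> hwf n d (hlead h).
Proof.
elim: h n d => [||l IHl r IHr] [|n] d //=.
case/andP=> wl wr; have wr' := IHr _ _ wr.
case: l IHl wl => [||l1 l2] IHl wl; first by rewrite /= wr'; case: (d).
  by rewrite /= andbT.
have : hwf n.+1 d (Node (hlead (Node l1 l2)) Zero); last by [].
by move: wl; rewrite /= andbT; case: (d) => // d'; apply: (IHl n.+1).
Qed.

Lemma hnf_hwf fuel n d t h g : tok (hwf n d) id t ->
  hwf n d h -> hwf n d g -> hwf n d (hnf fuel t h g).
Proof.
move=> tokw; elim: fuel h g => [|fuel IHfuel] h g wh wg; first exact: hwf_hadd.
rewrite hnfS; case: eqP => // _; case: eqP => [_|nf].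
  by apply: IHfuel; apply: hwf_hadd => //; apply: hwf_hlead.
have [/nf//|[wf _]] := tok_hfind h tokw.
by apply: IHfuel => //; apply: hwf_hadd.
Qed.

(** The context c stands for multiplication by the product a of the variables read so far. At a leaf
    the claim is the hypothesis on f; nodes are summed by [KD]. *)
Lemma happ_htab (K : P -> Prop) (f : hpoly -> hpoly) D n d c i (a : P) :
    K 0 -> (forall p q, K p -> K q -> K (p + q)) ->
    (forall h, hwf 4 D h ->
       hwf 4 D (f h) /\ K (heval 0 D h + heval 0 D (f h))) ->
    (forall h, hwf n d h -> hwf 4 D (c h)) ->
    (forall h, heval 0 D (c h) = a * heval i d h) ->
  forall h, hwf n d h -> hwf 4 D (happ (htab f n d c) h) /\
    K (heval 0 D (c h) + heval 0 D (happ (htab f n d c) h)).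
Proof.
move=> K0 KD fP; elim: n d c i a => [|n IHn] d c i a cw ce.
  case=> [||//] wh /=; first by rewrite ce /= mulr0 addr0.
  by apply: fP; apply: cw.
elim: d c a cw ce => [|d IHd] c a cw ce [|//|l r] wh.
- by rewrite ce /= mulr0 addr0.
- have /= /andP[/eqP l0 wr] := wh.
  have [] := IHn 0%N (fun h => c (Node Zero h)) i.+1 a _ _ r wr.
  + by move=> h wh'; apply: cw.
  + by move=> h; rewrite ce /= mulr0 add0r.
  by rewrite l0 /=.
- by rewrite ce /= mulr0 addr0.
have /= /andP[wl wr] := wh.
have [] := IHn d.+1 (fun h => c (Node Zero h)) i.+1 a _ _ r wr.
- by move=> h wh'; apply: cw.
- by move=> h; rewrite ce /= mulr0 add0r.
move=> w1 K1; have [] := IHd (fun h => c (Node h Zero)) (a * X i) _ _ l wl.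
- by move=> h wh'; apply: cw; rewrite /= wh'.
- by move=> h; rewrite ce /= addr0 mulrA.
move=> w2 K2; split; first exact: hwf_hadd.
rewrite heval_hadd.
have -> : heval 0 D (c (Node l r)) =
    heval 0 D (c (Node l Zero)) + heval 0 D (c (Node Zero r)).
  by rewrite !ce -mulrDr /= addr0 mulr0 add0r.
by rewrite addrACA; apply: KD.
Qed.

(** * Computation of Sq^k on monomials *)

Fixpoint parity_next (b : bool) (r : seq bool) : seq bool :=
  if r is b' :: r' then (b (+) b') :: parity_next b' r' else [:: b].

(** Rows 0 to 19 of Pascal's triangle modulo 2, enough for monomials of degree below 20. *)
Definition parities : seq (seq bool) := traject (parity_next false) [:: true] 20.

Lemma nth_parities n k : (n < 20)%N ->
  nth false (nth [::] parities n) k = odd 'C(n, k).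
Proof.
move=> ltn; rewrite (set_nth_default [:: true]) ?size_traject // nth_traject // => {ltn}.
have next b r l : nth false (parity_next b r) l =
    (if l is l'.+1 then nth false r l' else b) (+) nth false r l.
  elim: r b l => [|b' r IHr] b [|l] //=; rewrite ?addbF ?nth_nil //.
  by rewrite IHr; case: l.
elim: n k => [|n IHn] k; first by case: k => [|k]; rewrite /= ?nth_nil.
rewrite iterS next IHn; case: k => [|k]; first by rewrite !bin0.
by rewrite IHn binS oddD addbC.
Qed.

(** Shifting [Zero] would build a tree of zeros different from [Zero], whereas the elimination
    recognizes 0 by its syntax. *)
Definition hadd_shift a g h := if g is Zero then h else hadd (hshift a g) h.

Lemma heval_hadd_shift i d a g h : heval i d (hadd_shift a g h) =
  X i ^+ a * heval i.+1 (d - a) g + heval i d h.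
Proof.
case: g => [||l r]; first by rewrite mulr0 add0r.
  by rewrite heval_hadd heval_hshift.
by rewrite heval_hadd heval_hshift.
Qed.

Lemma hwf_hadd_shift n d a g h : hwf n d g -> hwf n.+1 (a + d) h ->
  hwf n.+1 (a + d) (hadd_shift a g h).
Proof. by case: g => [||l r] // wg wh; apply: hwf_hadd wh; apply: hwf_hshift. Qed.

(** The Cartan formula for X_i^a times a monomial in the later variables, on which the squares are
    given by g: j counts upwards from a, and row holds the binomial coefficients still to come. *)
Fixpoint hSq_row (g : nat -> hpoly) row j k : hpoly :=
  if row isn't b :: row' then Zero else
  let r := if k is k'.+1 then hSq_row g row' j.+1 k' else Zero in
  if b then hadd_shift j (g k) r else r.

Fixpoint hSq par ys k : hpoly := match ys with
  | [::] => Zero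
  | [:: a] => if nth false (nth [::] par a) k then One else Zero
  | a :: ys' => hSq_row (hSq par ys') (nth [::] par a) a k
  end.

Lemma Sq_mul_Xn k i a p : Sq k (X i ^+ a * p) =
  \sum_(j < k.+1) (odd 'C(a, j))%:R * (X i ^+ (a + j) * Sq (k - j) p).
Proof.
rewrite Sq_Cartan; apply: eq_bigr => j _.
by rewrite Sq_var scaler_nat -natrP mulrA mulr_natl.
Qed.

Lemma hSq_rowP g row i n e (G : nat -> P) j k :
    (forall k, heval i.+1 (e + k) (g k) = G k /\ hwf n (e + k) (g k)) ->
  heval i (j + (e + k)) (hSq_row g row j k) =
    \sum_(l < k.+1) (nth false row l)%:R * (X i ^+ (j + l) * G (k - l)%N) /\
  hwf n.+1 (j + (e + k)) (hSq_row g row j k).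
Proof.
move=> gP; elim: row j k => [|c row IHrow] j k /=.
  by rewrite big1 // => l _; rewrite nth_nil mul0r.
pose r := if k is k'.+1 then hSq_row g row j.+1 k' else Zero; rewrite -/r.
have [re rw] : heval i (j + (e + k)) r = \sum_(l < k)
    (nth false row l)%:R * (X i ^+ (j + l.+1) * G (k - l.+1)%N) /\
    hwf n.+1 (j + (e + k)) r.
  rewrite /r; case: (k) => [|k']; first by rewrite big_ord0.
  have := IHrow j.+1 k'; rewrite addnS addSnnS => -[-> ->].
  by split=> //; apply: eq_bigr => l _; rewrite subSS addSnnS.
rewrite big_ord_recl /= subn0 addn0.
case: c; last by rewrite mul0r add0r.
have [ge gw] := gP k; rewrite heval_hadd_shift addKn ge re mul1r.
by split=> //; apply: hwf_hadd_shift.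
Qed.

Lemma hSqP i ys k : (0 < size ys)%N -> all (fun a => a < 20)%N ys ->
  heval i (sumn ys + k) (hSq parities ys k) = Sq k (gmono i ys) /\
  hwf (size ys).-1 (sumn ys + k) (hSq parities ys k).
Proof.
elim: ys i k => [//|a [|b ys] IHys] i k _ /andP[lta ltys].
  rewrite /= nth_parities // addn0 Sq_var scaler_nat -[_ *+ _]mulr_natl natrP.
  by case: odd; rewrite ?mul1r ?mul0r.
have [he hw] := hSq_rowP (nth [::] parities a) a k
  (fun k' => IHys i.+1 k' isT ltys).
rewrite [sumn _]/(a + sumn (b :: ys))%N -addnA; split; last exact: hw.
rewrite [LHS]he; transitivity (Sq k (X i ^+ a * gmono i.+1 (b :: ys))) => //.
rewrite Sq_mul_Xn.
by apply: eq_bigr => l _; rewrite nth_parities.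
Qed.

Fixpoint expos n d : seq (seq nat) := if n isn't n'.+1 then [:: [:: d]] else
  flatten [seq [seq a :: ys | ys <- expos n' (d - a)%N] | a <- iota 0 d.+1].

Lemma mem_expos n d ys :
  (ys \in expos n d) = (size ys == n.+1) && (sumn ys == d).
Proof.
elim: n d ys => [|n IHn] d ys.
  rewrite /= inE; case: ys => [|a [|b ys]] //=; last by rewrite eqseq_cons andbF.
  by rewrite addn0 eqseq_cons andbT.
apply/flatten_mapP/andP => [[a ad /mapP[zs]]|].
  rewrite mem_iota ltnS /= in ad; rewrite -/expos IHn => /andP[/eqP szs /eqP sumz] ->.
  by rewrite /= szs sumz subnKC // !eqxx.
case: ys => [|a ys] [] //= szs /eqP sumy.
exists a; first by rewrite -[0%N :: _]/(iota 0 d.+1) mem_iota ltnS -sumy leq_addr.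
by rewrite mem_map => [|? ? [] //]; rewrite -/expos IHn -sumy addKn eqxx andbT.
Qed.

(** * The quotient in degree 41 *)

(** The second entry is the degree of y: 5 + 2 * 18 = 3 + 2 * 19 = 41. *)
Definition comps : seq (seq nat * nat) :=
  ([::], 18%N) :: [seq ([:: ik.1; ik.2], 19%N) | ik <- pairs].

(* Vectors of polynomials, indexed by comps: Node l r has first entry l. *)
Fixpoint veval (es : seq (seq nat * nat)) h : P := match es, h with
  | td :: es', Node l r => part td.1 (heval 0 td.2 l) + veval es' r
  | _, _ => 0
  end.

Fixpoint vwf (es : seq (seq nat * nat)) h : bool := match es, h with
  | _, Zero => true
  | td :: es', Node l r => hwf 4 td.2 l && vwf es' r
  | _, _ => false
  end.

Lemma veval_hnode es l r : veval es (hnode l r) = veval es (Node l r).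
Proof.
case: es => [|td es]; first by case: hnode.
by case: l r => [||? ?] [||? ?] //=; rewrite part0 add0r; case: es.
Qed.

Lemma vwf_hnode es l r : vwf es (Node l r) -> vwf es (hnode l r).
Proof. by case: es l r => [//|td es] [||? ?] [||? ?]. Qed.

(** As vectors are trees too, the elimination applies to them unchanged, with the first nonzero
    component leading. *)
Lemma veval_hadd es g h : veval es (hadd g h) = veval es g + veval es h.
Proof.
have add1 es' f : veval es' (hadd1 f) = veval es' f.
  elim: f es' => [||l _ r IHr] [|td es'] //=; by rewrite IHr.
elim: es g h => [|td es IHes] g h; first by rewrite addr0.
case: g h => [||l r] [||l' r']; rewrite ?addr0 ?add0r ?add1 //.
by rewrite [hadd _ _]/(hnode _ _) veval_hnode /= IHes heval_hadd partD addrACA.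
Qed.

Lemma vwf_hadd es g h : vwf es g -> vwf es h -> vwf es (hadd g h).
Proof.
elim: es g h => [|td es IHes] [||l r] [||l' r'] //= /andP[wl wr] /andP[wl' wr'].
by apply: (@vwf_hnode (td :: es)); rewrite /= hwf_hadd // IHes.
Qed.

Definition vcomb (s : seq hpoly) := foldr hnode Zero s.

Lemma vcombP (I : Type) (e : I -> seq nat * nat) (g : I -> hpoly) (s : seq I) :
  veval [seq e i | i <- s] (vcomb [seq g i | i <- s]) =
  \sum_(i <- s) part (e i).1 (heval 0 (e i).2 (g i)).
Proof.
elim: s => [|i s IHs]; first by rewrite big_nil.
by rewrite big_cons -IHs [LHS]veval_hnode.
Qed.

Lemma vwf_vcomb (I : eqType) (e : I -> seq nat * nat) (g : I -> hpoly) s :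
  {in s, forall i, hwf 4 (e i).2 (g i)} ->
  vwf [seq e i | i <- s] (vcomb [seq g i | i <- s]).
Proof.
elim: s => //= i s IHs wg.
apply: (@vwf_hnode (e i :: _)); rewrite /= wg ?mem_head // IHs // => j js.
by apply: wg; rewrite inE js orbT.
Qed.

Definition vinj (c : nat) h := iter c (Node Zero) (Node h Zero).

Lemma hlead_vinj c h : h != Zero -> hlead (vinj c h) = vinj c (hlead h).
Proof. by move=> nz; elim: c => [|c /= ->]; [case: h nz|]. Qed.

Lemma vinjP es c h : (c < size es)%N ->
  veval es (vinj c h) = part (nth ([::], 0%N) es c).1
    (heval 0 (nth ([::], 0%N) es c).2 h) /\
  (hwf 4 (nth ([::], 0%N) es c).2 h -> vwf es (vinj c h)).
Proof.
elim: c es => [|c IHc] [|td es] //= ltc.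
  by case: es {ltc} => [|? ?]; rewrite addr0 andbT.
have [<- w] := IHc es ltc.
by rewrite part0 add0r; split=> // /w ->.
Qed.

Lemma hmono_neq0 ys : hmono ys != Zero.
Proof. by case: ys => [|[|a] [|b ys]]. Qed.

Lemma hlead_hmono ys : hlead (hmono ys) = hmono ys.
Proof.
elim: ys => [|a [|b ys] IHys] //; rewrite [hmono _]/(hshift a (hmono (b :: ys))).
have := hmono_neq0 (b :: ys); move: (hmono _) IHys => h hh nz.
elim: a => [|a IHa]; first by rewrite /= hh.
by case: a IHa => [|a] /= ->.
Qed.

Lemma hlead_Node0 h m : hlead h = Node Zero m -> m != Zero ->
  exists2 r, h = Node Zero r & hlead r = m.
Proof.
case: h => [||l r] //=; case: l => [||? ?] //.
  by case=> <- _; exists r.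
by case=> _ <-.
Qed.

Lemma hlead_Node1 h m : hlead h = Node m Zero -> m != Zero ->
  exists l r, h = Node l r /\ hlead l = m.
Proof.
case: h => [||l r] //= + nz; case: l => [||l1 l2].
- by case=> m0; rewrite -m0 in nz.
- by case=> <-; exists One, r.
- by case=> <-; exists (Node l1 l2), r.
Qed.

Section Reduction.
Variable K : P -> Prop.
Hypothesis K0 : K 0.
Hypothesis KD : forall p q, K p -> K q -> K (p + q).

(* Monomials are eliminated starting from the last one in the order given by
   hlead, so that only the leading monomial of h is not yet known to be in K. *)
Lemma reduce_heval (T : P -> P) n d i a :
    T 0 = 0 -> (forall p q, T (p + q) = T p + T q) ->
    (forall ys, size ys = n.+1 -> sumn ys = d -> exists h,
       [/\ hwf n d h, hlead h = hmono ys & K (T (a * heval i d h))]) ->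
  forall h, hwf n d h -> K (T (a * heval i d h)).
Proof.
move=> T0 TD; elim: n d i a => [|n IHn] d i a red.
  case=> [_|_|//] /=; first by rewrite mulr0 T0.
  have [|h [wh lh]] := red [:: d] erefl; first by rewrite /= addn0.
  by case: h wh lh.
elim: d a red => [|d IHd] a red.
  have right r : hwf n 0 r -> K (T (a * heval i.+1 0 r)).
    apply: IHn => {r} -[//|b ys] sz sy.
    have [||h [wh lh Kh]] := red [:: 0%N, b & ys]; [by rewrite /= -sz|by []|].
    have [r hr lr] := hlead_Node0 (m := hmono (b :: ys)) lh (hmono_neq0 _).
    by exists r; move: wh Kh; rewrite hr /= mulr0 add0r.
  case=> [_|//|l r] /=; first by rewrite mulr0 T0.
  by case/andP=> /eqP-> wr; rewrite /= mulr0 add0r; apply: right.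
have right r : hwf n d.+1 r -> K (T (a * heval i.+1 d.+1 r)).
  apply: IHn => {r} -[//|b ys] sz sy.
  have [||h [wh lh Kh]] := red [:: 0%N, b & ys]; [by rewrite /= -sz|by []|].
  have [r hr lr] := hlead_Node0 (m := hmono (b :: ys)) lh (hmono_neq0 _).
  by exists r; move: wh Kh; rewrite hr /= mulr0 add0r.
have left l : hwf n.+1 d l -> K (T (a * X i * heval i d l)).
  apply: IHd => {l} [[|b [|c ys]] // sz sy].
  have [||h [wh lh Kh]] := red [:: b.+1, c & ys]; [by []|by rewrite /= -sy|].
  have [l [r [hl ll]]] := hlead_Node1 (m := hmono [:: b, c & ys]) lh (hmono_neq0 _).
  move: wh Kh; rewrite hl /= mulrDr TD mulrA => /andP[wl wr] Kl.
  by exists l; split=> //; apply: (K_addr KD (right r wr)).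
case=> [_|//|l r] /=; first by rewrite mulr0 T0.
case/andP=> wl wr; rewrite mulrDr TD mulrA.
by apply: KD; [apply: left|apply: right].
Qed.

Lemma reduce_part t d :
    (forall ys, size ys = 5%N -> sumn ys = d -> exists h,
       [/\ hwf 4 d h, hlead h = hmono ys & K (part t (heval 0 d h))]) ->
  forall h, hwf 4 d h -> K (part t (heval 0 d h)).
Proof.
move=> red h wh; rewrite -[heval _ _ _]mul1r.
apply: reduce_heval wh => [||ys sz sy]; first exact: part0.
  exact: partD.
by have [g [wg lg Kg]] := red ys sz sy; exists g; rewrite mul1r.
Qed.

Lemma reduce_veval es :
    (forall c ys, (c < size es)%N -> size ys = 5%N ->
       sumn ys = (nth ([::], 0%N) es c).2 -> exists h,
       [/\ vwf es h, hlead h = vinj c (hmono ys) & K (veval es h)]) ->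
  forall h, vwf es h -> K (veval es h).
Proof.
elim: es => [|[t d] es IHes] red; first by case.
have Kr r : vwf es r -> K (veval es r).
  apply: IHes => {r} c ys ltc sz sy.
  have [//|h [wh lh Kh]] := red c.+1 ys _ sz sy.
  have [|r hr lr] := hlead_Node0 lh; first by case: (c).
  by exists r; move: wh Kh; rewrite hr /= part0 add0r.
case=> [_|//|l r] //= /andP[wl wr]; apply: KD (Kr r wr).
apply: reduce_part wl => ys sz sy.
have [//|h [wh lh Kh]] := red 0%N ys _ sz sy.
have [l' [r' [hl ll]]] := hlead_Node1 lh (hmono_neq0 ys).
move: wh Kh; rewrite hl /= => /andP[wl' wr'] Klr.
by exists l'; split=> //; apply: (K_addr KD (Kr r' wr')).
Qed.

End Reduction.

Definition hrels par d ks : seq hpoly :=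
  [seq hSq par ys k | k <- ks, ys <- expos 4 (d - k)].

Definition nonpivots t n d : seq (seq nat) :=
  [seq ys <- expos n d | hfind t (hmono ys) == Zero].

Definition hnf_table fuel t d : table :=
  htab (fun h => hnf fuel t h Zero) 4 d id.

Definition incr i ys := set_nth 0%N ys i (nth 0%N ys i).+1.

(** [B_elt] has no component with |S| = 5, whence the first entry [Zero]; the pair entries are
    replaced by their values under [tab19], the table of normal forms in degree 19. *)
Definition B_row tab19 j ys : hpoly :=
  vcomb (Zero :: [seq if ik.1 == j then happ tab19 (hmono (incr ik.2 ys)) else
                      if ik.2 == j then happ tab19 (hmono (incr ik.1 ys)) else
                      Zero | ik <- pairs]).

Definition C_row par tab19 tab18 ys : hpoly :=
  vcomb (happ tab18 (hSq par ys 1) ::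
         [seq happ tab19 (hmono (incr ik.1 (incr ik.2 ys))) | ik <- pairs]).

Lemma incrP i ys : size ys = 5%N -> (i < 5)%N ->
  [/\ size (incr i ys) = 5%N, sumn (incr i ys) = (sumn ys).+1 &
      mono (incr i ys) = X i * mono ys].
Proof.
move=> sz lti; rewrite /incr size_set_nth sz; split.
- by apply/maxn_idPr.
- case: ys sz => [|a [|b [|c [|d [|e [|]]]]]] //= _.
  by case: i lti => [|[|[|[|[|]]]]] //=; lia.
have i5 : i \in iota 0 5 by rewrite mem_iota.
rewrite /mono !(bigD1_seq i i5 (iota_uniq 0 5)).
rewrite nth_set_nth /= eqxx exprS mulrA; congr (_ * _).
by apply: eq_bigr => j /negPf ne; rewrite nth_set_nth /= ne.
Qed.

Lemma hmonoP ys d : size ys = 5%N -> sumn ys = d ->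
  heval 0 d (hmono ys) = mono ys /\ hwf 4 d (hmono ys).
Proof.
move=> sz <-; rewrite heval_hmono ?sz // gmonoE //; split=> //.
by have := hwf_hmono (ys := ys); rewrite sz; apply.
Qed.

Lemma hSq_monoP ys k d : size ys = 5%N -> (sumn ys + k)%N = d -> (sumn ys < 20)%N ->
  heval 0 d (hSq parities ys k) = Sq k (mono ys) /\
  hwf 4 d (hSq parities ys k).
Proof.
move=> sz <- lt20; have [||] := @hSqP 0 ys k; rewrite ?sz ?gmonoE //.
apply/allP => a ay; apply: leq_ltn_trans lt20.
by rewrite sumnE (big_rem a) //= leq_addr.
Qed.

Lemma sum_pairs_B j f : (j < 5)%N ->
  \sum_(ik <- pairs) part [:: ik.1; ik.2]
     (if ik.1 == j then f ik.2 else if ik.2 == j then f ik.1 else 0) =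
  B_elt j f.
Proof.
by case: j => [|[|[|[|[|//]]]]] _; rewrite /B_elt !big_cons !big_nil /=
  ?part0 ?add0r ?addr0.
Qed.

(** * Elimination modulo some of the Sq^k in one degree *)

Section Stage.
Variables (d fuel : nat) (ks : seq nat) (st : table * seq hpoly).
Hypothesis lt_d : (d < 20)%N.
Hypothesis ksP : {in ks, forall k, (0 < k <= d)%N}.
Hypothesis stE : helim fuel (hrels parities d ks) = Some st.
Variable K : P -> Prop.
Hypothesis K0 : K 0.
Hypothesis KD : forall p q, K p -> K q -> K (p + q).

Lemma hrelsP h : h \in hrels parities d ks -> exists k ys,
  [/\ k \in ks, mono ys \is (d - k).-homog, heval 0 d h = Sq k (mono ys) &
      hwf 4 d h].
Proof.
case/allpairsPdep => k [ys [kks]]; rewrite mem_expos => /andP[/eqP sz /eqP sy] ->.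
have /andP[_ lek] := ksP kks; exists k, ys; rewrite -{1}sy mono_homog //.
have [||] := @hSq_monoP ys k d sz; rewrite ?sy ?subnK //.
exact: leq_ltn_trans (leq_subr _ _) lt_d.
Qed.

Lemma stage_hit : (forall k v, k \in ks -> v \is (d - k).-homog -> K (Sq k v)) ->
  tok (fun h => hwf 4 d h /\ K (heval 0 d h)) id st.1 /\
  {in st.2, forall g, hwf 4 d g /\ K (heval 0 d g)}.
Proof.
move=> KSq; apply: helim_closed stE => [g h [wg Kg] [wh Kh]|h].
  by split; [apply: hwf_hadd|rewrite heval_hadd; apply: KD].
by case/hrelsP => k [ys [kks hy -> wh]]; split=> //; apply: KSq.
Qed.

Lemma stage_wf : tok (hwf 4 d) id st.1 /\ {in st.2, forall g, hwf 4 d g}.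
Proof.
by apply: helim_closed stE => [|h /hrelsP[k [ys []]] //]; apply: hwf_hadd.
Qed.

Hypothesis Krows : {in st.2, forall g, K (heval 0 d g)}.

Lemma stage_tok : tok (K \o heval 0 d) id st.1.
Proof.
by have [] := helim_span K0 KD (erefl : heval 0 d Zero = 0) (@heval_hadd 0 d) stE Krows.
Qed.

Lemma stage_Sq k v : k \in ks -> v \is (d - k).-homog -> K (Sq k v).
Proof.
move=> kks hv; have /andP[_ lek] := ksP kks.
have [_ Krels] :=
  helim_span K0 KD (erefl : heval 0 d Zero = 0) (@heval_hadd 0 d) stE Krows.
elim/homog_mono_ind: v / hv => [|p q|ys sz sy]; first by rewrite Sq0r.
  by rewrite SqD; apply: KD.
have [||<- _] := @hSq_monoP ys k d sz; rewrite ?sy ?subnK //.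
  exact: leq_ltn_trans (leq_subr _ _) lt_d.
apply: Krels; apply: allpairs_f_dep => //.
by rewrite mem_expos sz sy !eqxx.
Qed.

Lemma stage_nf h : hwf 4 d h ->
  hwf 4 d (happ (hnf_table fuel st.1 d) h) /\
  K (heval 0 d h + heval 0 d (happ (hnf_table fuel st.1 d) h)).
Proof.
apply: (happ_htab K0 KD (a := 1) (i := 0)) => // [g wg|g]; last by rewrite mul1r.
split; first by apply: hnf_hwf => //; have [] := stage_wf.
have := hnf_span K0 KD (erefl : heval 0 d Zero = 0) (@heval_hadd 0 d)
  fuel g Zero stage_tok.
by rewrite add0r addrC.
Qed.

End Stage.

(* The omitted relations j = 0 follow from sum_B_elt. *)
Definition vrels par tab19 tab18 t18 t17 : seq hpoly :=
  [seq B_row tab19 j ys | ys <- nonpivots t18 4 18,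
     j <- if nth 0%N ys 0 == 0%N then iota 0 5 else iota 1 4] ++
  [seq C_row par tab19 tab18 ys | ys <- nonpivots t17 4 17].

Lemma mem_nonpivots t n d ys : (ys \in nonpivots t n d) =
  [&& hfind t (hmono ys) == Zero, size ys == n.+1 & sumn ys == d].
Proof. by rewrite mem_filter mem_expos. Qed.

Section Rows.
Variables (K : P -> Prop) (tab19 tab18 : table).
Hypothesis K0 : K 0.
Hypothesis KD : forall p q, K p -> K q -> K (p + q).
Hypothesis tab19P : forall h, hwf 4 19 h -> hwf 4 19 (happ tab19 h) /\
  forall ik, ik \in pairs ->
  K (part [:: ik.1; ik.2] (heval 0 19 h + heval 0 19 (happ tab19 h))).
Hypothesis tab18P : forall h, hwf 4 18 h -> hwf 4 18 (happ tab18 h) /\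
  K (part [::] (heval 0 18 h + heval 0 18 (happ tab18 h))).

Lemma pair_lt5 ik : ik \in pairs -> (ik.1 < 5)%N /\ (ik.2 < 5)%N.
Proof. by move=> pik; apply/andP; move: ik pik; apply/allP. Qed.

Lemma B_rowP j ys : (j < 5)%N -> size ys = 5%N -> sumn ys = 18%N ->
  K (B_elt j (fun i => X i * mono ys) + veval comps (B_row tab19 j ys)) /\
  vwf comps (B_row tab19 j ys).
Proof.
move=> ltj sz sy.
have hX i : (i < 5)%N -> heval 0 19 (hmono (incr i ys)) = X i * mono ys /\
    hwf 4 19 (hmono (incr i ys)).
  move=> lti; have [szi syi <-] := incrP sz lti.
  by apply: hmonoP; rewrite ?syi ?sy.
pose g i := happ tab19 (hmono (incr i ys)).
pose f ik := if ik.1 == j then g ik.2 else if ik.2 == j then g ik.1 else Zero.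
have fw ik : ik \in pairs -> hwf 4 19 (f ik).
  case/pair_lt5 => lt1 lt2; rewrite /f.
  case: ifP => _; first by have [_ /tab19P[]] := hX _ lt2.
  by case: ifP => _ //; have [_ /tab19P[]] := hX _ lt1.
have vE : veval comps (B_row tab19 j ys) =
    \sum_(ik <- pairs) part [:: ik.1; ik.2] (heval 0 19 (f ik)).
  transitivity (part [::] 0 + veval (behead comps) (vcomb (map f pairs))).
    exact: veval_hnode.
  by rewrite part0 add0r -(vcombP (fun ik => ([:: ik.1; ik.2], 19%N)) f).
split.
  rewrite vE -sum_pairs_B // -big_split big_seq.
  apply: (big_ind K K0 KD) => ik pik /=.
  rewrite -partD /f; have [lt1 lt2] := pair_lt5 pik.
  case: eqP => [_|_]; first by case: (hX _ lt2) => <- /tab19P[_]; apply.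
  case: eqP => [_|_]; first by case: (hX _ lt1) => <- /tab19P[_]; apply.
  by rewrite addr0 part0.
apply: (@vwf_hnode comps); rewrite /=.
exact: (vwf_vcomb (e := fun ik : nat * nat => ([:: ik.1; ik.2], 19%N)) fw).
Qed.

Lemma C_rowP ys : size ys = 5%N -> sumn ys = 17%N ->
  K (C_elt (mono ys) + veval comps (C_row parities tab19 tab18 ys)) /\
  vwf comps (C_row parities tab19 tab18 ys).
Proof.
move=> sz sy.
pose f ik := happ tab19 (hmono (incr ik.1 (incr ik.2 ys))).
have hX ik : ik \in pairs ->
    heval 0 19 (hmono (incr ik.1 (incr ik.2 ys))) =
      X ik.1 * (X ik.2 * mono ys) /\
    hwf 4 19 (hmono (incr ik.1 (incr ik.2 ys))).
  case/pair_lt5 => lt1 lt2; have [sz2 sy2 <-] := incrP sz lt2.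
  have [sz1 sy1 <-] := incrP sz2 lt1.
  by apply: hmonoP; rewrite ?sy1 ?sy2 ?sy.
have fw : {in pairs, forall ik, hwf 4 19 (f ik)}.
  by move=> ik /hX[_ /tab19P[]].
have sy17 : (sumn ys < 20)%N by rewrite sy.
have [Se /tab18P[wS KS]] := @hSq_monoP ys 1 18 sz (congr1 (addn^~ 1%N) sy) sy17.
have fc := vwf_vcomb (e := fun ik : nat * nat => ([:: ik.1; ik.2], 19%N)) fw.
split.
  have -> : veval comps (C_row parities tab19 tab18 ys) =
      part [::] (heval 0 18 (happ tab18 (hSq parities ys 1))) +
      veval (behead comps) (vcomb (map f pairs)) by exact: veval_hnode.
  rewrite (vcombP (fun ik => ([:: ik.1; ik.2], 19%N)) f).
  rewrite /C_elt addrACA; apply: KD; first by rewrite -partD -Se.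
  rewrite -big_split big_seq; apply: (big_ind K K0 KD) => ik pik /=.
  by rewrite -partD; have [<- /tab19P[_]] := hX _ pik; apply.
by apply: (@vwf_hnode comps); rewrite /= wS.
Qed.
End Rows.

(** Over F_2, closure under addition already gives the linear span. *)
Inductive inspan (s : seq P) : P -> Prop :=
| inspan0 : inspan s 0
| inspanD p q : inspan s p -> inspan s q -> inspan s (p + q)
| mem_inspan p : p \in s -> inspan s p.

(** Together with the image of the Sq^k, the non-pivot monomials span degree d, so an additive T has
    to be examined on these two families only. *)
Lemma stage_reduce d fuel ks st (K : P -> Prop) (T : P -> P) :
    (d < 20)%N -> {in ks, forall k, (0 < k <= d)%N} ->
    helim fuel (hrels parities d ks) = Some st ->
    K 0 -> (forall p q, K p -> K q -> K (p + q)) ->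
    T 0 = 0 -> (forall p q, T (p + q) = T p + T q) ->
    (forall k v, k \in ks -> v \is (d - k).-homog -> K (T (Sq k v))) ->
    (forall ys, ys \in nonpivots st.1 4 d -> K (T (mono ys))) ->
  forall u, u \is d.-homog -> K (T u).
Proof.
move=> ltd ksP E K0 KD T0 TD KSq Kmono u.
have KTD p q : (K \o T) p -> (K \o T) q -> (K \o T) (p + q).
  by rewrite /= TD; apply: KD.
have [tokT _] := stage_hit ltd ksP E KTD KSq.
move=> hu; elim/homog_mono_ind: u / hu => [|p q Kp Kq|ys sz sy].
  by rewrite T0.
  by rewrite TD; apply: KD.
have [<- wy] := hmonoP sz sy; rewrite -[heval _ _ _]mul1r.
apply: (reduce_heval K0 KD T0 TD) wy => {sz sy} zs sz sy.
have [|[[wf Kf] lf]] := tok_hfind (hmono zs) tokT; last first.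
  by exists (hfind st.1 (hmono zs)); rewrite mul1r lf hlead_hmono.
move=> fz; have [ez wz] := hmonoP sz sy.
exists (hmono zs); rewrite hlead_hmono mul1r ez; split=> //.
by apply: Kmono; rewrite mem_nonpivots fz sz sy !eqxx.
Qed.

Definition vmonos t19 t18 : seq hpoly :=
  [seq vinj 0 (hmono ys) | ys <- nonpivots t18 4 18] ++
  [seq vinj c (hmono ys) | c <- iota 1 10, ys <- nonpivots t19 4 19].

Definition vnonpivots t19 t18 t : seq hpoly :=
  [seq h <- vmonos t19 t18 | hfind t h == Zero].

(** * Spanning sets of the quotient and of the hit polynomials *)

Section Assembly.
Variables (fuel : nat) (st19 st18 st17 st : table * seq hpoly).
Variables tab19 tab18 : table.
Hypothesis tab19E : tab19 = hnf_table fuel st19.1 19.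
Hypothesis tab18E : tab18 = hnf_table fuel st18.1 18.
(** By [Sq_top], Sq^k vanishes in degree 19 - k, resp. 18 - k, once k > 9. In degree 17 it is the
    image of Sq^1 that [K_C_Sq1] deals with. *)
Let ks19 := iota 1 9.
Let ks18 := [:: 2; 4; 6; 8]%N.
Let ks17 := [:: 1%N].
Hypothesis E19 : helim fuel (hrels parities 19 ks19) = Some st19.
Hypothesis E18 : helim fuel (hrels parities 18 ks18) = Some st18.
Hypothesis E17 : helim fuel (hrels parities 17 ks17) = Some st17.
Hypothesis E : helim fuel (vrels parities tab19 tab18 st18.1 st17.1) = Some st.

Let ks19P : {in ks19, forall k, (0 < k <= 19)%N}.
Proof. exact/allP. Qed.

Let ks18P : {in ks18, forall k, (0 < k <= 18)%N}.
Proof. exact/allP. Qed.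

Let ks17P : {in ks17, forall k, (0 < k <= 17)%N}.
Proof. exact/allP. Qed.

Section Tables.
Variable K : P -> Prop.
Hypothesis K0 : K 0.
Hypothesis KD : forall p q, K p -> K q -> K (p + q).
Hypothesis K19 : {in st19.2, forall g ik, ik \in pairs ->
  K (part [:: ik.1; ik.2] (heval 0 19 g))}.
Hypothesis K18 : {in st18.2, forall g, K (part [::] (heval 0 18 g))}.

Lemma Kpairs0 ik : ik \in pairs -> K (part [:: ik.1; ik.2] 0).
Proof. by rewrite part0. Qed.

Lemma KpairsD p q : (forall ik, ik \in pairs -> K (part [:: ik.1; ik.2] p)) ->
  (forall ik, ik \in pairs -> K (part [:: ik.1; ik.2] q)) ->
  forall ik, ik \in pairs -> K (part [:: ik.1; ik.2] (p + q)).
Proof. by move=> Kp Kq ik pik; rewrite partD; apply: KD; [apply: Kp|apply: Kq]. Qed.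

Lemma Kfull0 : K (part [::] 0).
Proof. by rewrite part0. Qed.

Lemma KfullD p q : K (part [::] p) -> K (part [::] q) -> K (part [::] (p + q)).
Proof. by rewrite partD; apply: KD. Qed.

Lemma tab19P h : hwf 4 19 h -> hwf 4 19 (happ tab19 h) /\
  forall ik, ik \in pairs ->
  K (part [:: ik.1; ik.2] (heval 0 19 h + heval 0 19 (happ tab19 h))).
Proof.
rewrite tab19E.
exact: (stage_nf (isT : (19 < 20)%N) ks19P E19 Kpairs0 KpairsD K19).
Qed.

Lemma tab18P h : hwf 4 18 h -> hwf 4 18 (happ tab18 h) /\
  K (part [::] (heval 0 18 h + heval 0 18 (happ tab18 h))).
Proof.
rewrite tab18E.
exact: (stage_nf (isT : (18 < 20)%N) ks18P E18 Kfull0 KfullD K18).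
Qed.

Lemma vrelsP h : h \in vrels parities tab19 tab18 st18.1 st17.1 ->
  vwf comps h /\
  ((exists j ys, [/\ (j < 5)%N, size ys = 5%N, sumn ys = 18%N &
     K (B_elt j (fun i => X i * mono ys) + veval comps h)]) \/
   (exists ys, [/\ size ys = 5%N, sumn ys = 17%N &
     K (C_elt (mono ys) + veval comps h)])).
Proof.
rewrite mem_cat => /orP[/allpairsPdep[ys [j]]|/mapP[ys]].
  rewrite mem_nonpivots => -[/and3P[_ /eqP sz /eqP sy] jP ->].
  have ltj : (j < 5)%N by move: jP; case: ifP => _; rewrite mem_iota; case/andP.
  have [KB wB] := B_rowP K0 KD tab19P ltj sz sy; split; first exact: wB.
  left; exists j, ys; split; [exact: ltj|exact: sz|exact: sy|exact: KB].
rewrite mem_nonpivots => /and3P[_ /eqP sz /eqP sy] ->.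
have [KC wC] := C_rowP K0 KD tab19P tab18P sz sy; split; first exact: wC.
right; exists ys; split; [exact: sz|exact: sy|exact: KC].
Qed.

End Tables.

Lemma hit_rows19 :
  tok (fun h => hwf 4 19 h /\ forall ik, ik \in pairs ->
         hit (part [:: ik.1; ik.2] (heval 0 19 h))) id st19.1 /\
  {in st19.2, forall h, hwf 4 19 h /\ forall ik, ik \in pairs ->
         hit (part [:: ik.1; ik.2] (heval 0 19 h))}.
Proof.
apply: (stage_hit (isT : (19 < 20)%N) ks19P E19
  (KpairsD (@hitD 5))) => k v kks hv ik pik.
by have /andP[k_gt0 lek] := ks19P kks; exact: (hit_part2 pik k_gt0 lek hv).
Qed.

Lemma hit_rows18 :
  tok (fun h => hwf 4 18 h /\ hit (part [::] (heval 0 18 h))) id st18.1 /\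
  {in st18.2, forall h, hwf 4 18 h /\ hit (part [::] (heval 0 18 h))}.
Proof.
apply: (stage_hit (isT : (18 < 20)%N) ks18P E18
  (KfullD (@hitD 5))) => k v kks hv.
have /andP[k_gt0 lek] := ks18P kks; apply: (hit_part0 k_gt0 _ lek hv).
by move: k kks {k_gt0 lek hv}; apply/allP.
Qed.

Lemma hit_rows :
  tok (fun h => vwf comps h /\ hit (veval comps h)) id st.1 /\
  {in st.2, forall h, vwf comps h /\ hit (veval comps h)}.
Proof.
apply: helim_closed E => [g h [wg Kg] [wh Kh]|h].
  by split; [apply: vwf_hadd|rewrite veval_hadd; apply: hitD].
have [_ r19] := hit_rows19; have [_ r18] := hit_rows18.
case/(vrelsP (@hit0 5) (@hitD 5) (fun g gs => proj2 (r19 g gs))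
  (fun g gs => proj2 (r18 g gs))) => wh vP; split; first exact: wh.
case: vP => [[j [ys [ltj sz sy hB]]]|[ys [sz sy hC]]].
  have hy : mono ys \is 18.-homog by rewrite -sy mono_homog.
  by apply: (hit_addr (hit_B_elt ltj hy)); rewrite addrC; exact: hB.
have hy : mono ys \is 17.-homog by rewrite -sy mono_homog.
by apply: (hit_addr (hit_C_elt hy)); rewrite addrC; exact: hC.
Qed.

Let basis := [seq veval comps h | h <- vnonpivots st19.1 st18.1 st.1].

Let spanned p := exists2 q, inspan basis q & hit (p + q).

Let spanned_hit p : hit p -> spanned p.
Proof. by exists 0; [exact: inspan0|rewrite addr0]. Qed.

Let spannedD p q : spanned p -> spanned q -> spanned (p + q).
Proof.
move=> [p' sp hp] [q' sq hq]; exists (p' + q'); first exact: inspanD.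
by rewrite addrACA; apply: hitD.
Qed.

Lemma mem_comps c : (c < size comps)%N -> nth ([::], 0%N) comps c =
  if c is c'.+1 then ([:: (nth (0, 0)%N pairs c').1;
    (nth (0, 0)%N pairs c').2], 19%N)
  else ([::], 18%N).
Proof. by case: c => [_|c ltc]; [|apply: (nth_map (0, 0)%N)]. Qed.

(** A monomial leads a row of the last elimination, or a row of the elimination in its own
    component, both of which are hit; failing both, it belongs to [basis]. *)
Lemma veval_spanned h : vwf comps h -> spanned (veval comps h).
Proof.
apply: reduce_veval => [||c ys ltc sz sy]; first exact: spanned_hit (@hit0 5).
  exact: spannedD.
have nz := hmono_neq0 ys; have lm := hlead_hmono ys.
have [[tok19 _] [tok18 _] [tokV _]] := And3 hit_rows19 hit_rows18 hit_rows.
have lv : hlead (vinj c (hmono ys)) = vinj c (hmono ys).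
  by rewrite hlead_vinj ?lm.
have [fV|[[wV hV] lV]] := tok_hfind (vinj c (hmono ys)) tokV; last first.
  exists (hfind st.1 (vinj c (hmono ys))).
  split; [exact: wV|by rewrite lV lv|exact: spanned_hit].
have base g : hwf 4 (nth ([::], 0%N) comps c).2 g -> hlead g = hmono ys ->
    hit (part (nth ([::], 0%N) comps c).1
      (heval 0 (nth ([::], 0%N) comps c).2 g)) ->
    exists h, [/\ vwf comps h, hlead h = vinj c (hmono ys) &
      spanned (veval comps h)].
  move=> wg lg hg; have [ge gw] := vinjP g ltc.
  exists (vinj c g); split; first exact: gw wg.
    have gnz : g != Zero by rewrite -hlead_eq0 lg; exact: nz.
    by rewrite (hlead_vinj c gnz) lg.
  by apply: spanned_hit; rewrite ge; exact: hg.
have new : vinj c (hmono ys) \in vmonos st19.1 st18.1 ->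
    exists h, [/\ vwf comps h, hlead h = vinj c (hmono ys) &
      spanned (veval comps h)].
  have [_ bwf] := vinjP (hmono ys) ltc; have [_ wys] := hmonoP sz sy.
  move=> cm; exists (vinj c (hmono ys)); split; [exact: bwf wys|exact: lv|].
  exists (veval comps (vinj c (hmono ys))).
    apply: mem_inspan; apply: map_f; rewrite /vnonpivots mem_filter fV eqxx;
      exact: cm.
  by rewrite addPP; exact: hit0.
move: sy base; rewrite (mem_comps ltc).
case: c ltc lv fV new => [|c] ltc lv fV new sy base.
  have [f0|[[wf hf] lf]] := tok_hfind (hmono ys) tok18; last first.
    by apply: base wf _ hf; rewrite lf lm.
  apply: new; rewrite mem_cat; apply/orP; left; apply: map_f.
  by rewrite mem_nonpivots f0 sz sy !eqxx.
have [f0|[[wf hf] lf]] := tok_hfind (hmono ys) tok19; last first.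
  apply: base wf _ _; first by rewrite lf lm.
  by apply: hf; apply: mem_nth; exact: ltc.
apply: new; rewrite mem_cat; apply/orP; right; apply: allpairs_f.
  by rewrite mem_iota; exact: ltc.
by rewrite mem_nonpivots f0 sz sy !eqxx.
Qed.

Lemma homog_spanned p : p \is 41.-homog -> spanned p.
Proof.
move=> hp; elim/homog_mono_ind: p / hp => [|q r|ys sz sy].
- exact: spanned_hit (@hit0 5).
- exact: spannedD.
have szh : size (map half ys) = 5%N by rewrite size_map.
have sy' := sumn_split sz; rewrite sy in sy'.
have comp c : (c < size comps)%N ->
    sumn (map half ys) = (nth ([::], 0%N) comps c).2 ->
    odds ys = compl (nth ([::], 0%N) comps c).1 -> spanned (mono ys).
  move=> ltc sd oc; have [me mw] := hmonoP szh sd.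
  have [ve vw] := vinjP (hmono (map half ys)) ltc.
  have := veval_spanned (vw mw); rewrite ve me /part -oc.
  by rewrite -(mono_split sz); apply.
case: (odds_cases ys) => [le2|[ik pik es]|[j ltj es]|es].
- rewrite (mono_split sz); apply: spanned_hit.
  exact: (hit_low le2 (mono_homog szh) (esym sy')).
- have sz3 : size (odds ys) = 3%N.
    by rewrite es; apply/eqP; move: (ik) (pik); apply/allP.
  have ltc : ((index ik pairs).+1 < size comps)%N by have := pik;
    rewrite -index_mem.
  apply: (comp _ ltc); rewrite (mem_comps ltc); first by rewrite [RHS]/=; lia.
  rewrite (nth_index (0, 0)%N pik); exact: es.
(* With |S| = 4 the degree would be even. *)
- have sz4 : size (odds ys) = 4%N by rewrite es; case: (j) ltj => [|[|[|[|[|]]]]].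
  by exfalso; lia.
have sz5 : size (odds ys) = 5%N by rewrite es.
apply: (comp 0%N); [by []|rewrite [RHS]/=; lia|exact: es].
Qed.

(** The first family is the case |S| = 1, in which degree 41 forces y to have degree 20. *)
Definition rows : seq P :=
  [seq X i * mono ys ^+ 2 | i <- iota 0 5, ys <- expos 4 20] ++
  [seq part [:: ik.1; ik.2] (heval 0 19 g) | ik <- pairs, g <- st19.2] ++
  [seq part [::] (heval 0 18 g) | g <- st18.2] ++
  [seq veval comps g | g <- st.2].

Let K0 : inspan rows 0 := @inspan0 rows.
Let KD p q : inspan rows p -> inspan rows q -> inspan rows (p + q) :=
  @inspanD rows p q.

Let K19 : {in st19.2, forall g ik, ik \in pairs ->
  inspan rows (part [:: ik.1; ik.2] (heval 0 19 g))}.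
Proof.
move=> g gs ik pik; apply: mem_inspan.
rewrite mem_cat; apply/orP; right; rewrite mem_cat; apply/orP; left.
exact: (allpairs_f (fun ik g => part [:: ik.1; ik.2] (heval 0 19 g)) pik gs).
Qed.

Let K18 : {in st18.2, forall g, inspan rows (part [::] (heval 0 18 g))}.
Proof.
move=> g gs; apply: mem_inspan; do 2![rewrite mem_cat; apply/orP; right].
rewrite mem_cat; apply/orP; left.
exact: (map_f (fun g => part [::] (heval 0 18 g)) gs).
Qed.

Let Kv : {in vrels parities tab19 tab18 st18.1 st17.1, forall h,
  inspan rows (veval comps h)}.
Proof.
have [|_] := helim_span K0 KD (erefl : veval comps Zero = 0)
  (@veval_hadd comps) E; last by apply.
move=> g gs; apply: mem_inspan; do 3![rewrite mem_cat; apply/orP; right].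
exact: (map_f (veval comps) gs).
Qed.

Let Klow s d v : (size s <= 2%N)%N -> v \is d.-homog ->
  (size s + d.*2)%N = 41%N -> inspan rows (sqfree s * v ^+ 2).
Proof.
move=> les hv e41; have [sz1 d20] : size s = 1%N /\ d = 20%N by lia.
have -> : s = [:: head 0%N s] by case: s sz1 {les e41} => [|i []].
move: (head _ _) hv => i; rewrite /sqfree big_seq1 d20 => hv.
elim/homog_mono_ind: v / hv => [|p q Kp Kq|ys sz sy].
- by rewrite expr0n mulr0; exact: K0.
- by rewrite sqrPD mulrDr; exact: KD.
(* The index may be out of range; [X] reads it through [inord] as one in range. *)
have -> : X i = X (inord i : 'I_5) by rewrite /X inord_val.
apply: mem_inspan; rewrite mem_cat; apply/orP; left.
apply: (allpairs_f (fun i ys => X i * mono ys ^+ 2)).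
  by rewrite mem_iota; exact: (ltn_ord (inord i : 'I_5)).
by rewrite mem_expos sz sy !eqxx.
Qed.

Let Kpair ik k v : ik \in pairs -> (0 < k)%N -> (k <= 19)%N ->
  v \is (19 - k).-homog -> inspan rows (part [:: ik.1; ik.2] (Sq k v)).
Proof.
move=> pik k_gt0 lek hv; have [lek9|lt9k] := leqP k 9.
  have kks : k \in ks19 by rewrite mem_iota; lia.
  exact: (stage_Sq (isT : (19 < 20)%N) ks19P E19
    (@Kpairs0 _ K0) (KpairsD KD) K19 kks hv ik pik).
have [_ ->] := Sq_top hv; first by rewrite part0; exact: K0.
by lia.
Qed.

Let Keven k v : (0 < k)%N -> ~~ odd k -> (k <= 18)%N ->
  v \is (18 - k).-homog -> inspan rows (part [::] (Sq k v)).
Proof.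
move=> k_gt0 evk lek hv; have [lek9|lt9k] := leqP k 9.
  have kks : k \in ks18.
    by move: k {hv} k_gt0 evk lek lek9 => [|[|[|[|[|[|[|[|[|[|?]]]]]]]]]].
  exact: (stage_Sq (K := fun p => inspan rows (part [::] p))
    (isT : (18 < 20)%N) ks18P E18 (Kfull0 K0) (KfullD KD) K18 kks hv).
have [_ ->] := Sq_top hv; first by rewrite part0; exact: K0.
by lia.
Qed.

Let K_B_mono j ys : (j < 5)%N -> ys \in nonpivots st18.1 4 18 ->
  j \in (if nth 0%N ys 0 == 0%N then iota 0 5 else iota 1 4) ->
  inspan rows (B_elt j (fun i => X i * mono ys)).
Proof.
move=> ltj ys18 jys; have := ys18; rewrite mem_nonpivots.
case/and3P=> _ /eqP sz /eqP sy.
have [KB _] := B_rowP K0 KD (tab19P K0 KD K19) ltj sz sy.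
apply: (K_addr KD _ KB); apply: Kv; rewrite mem_cat; apply/orP; left.
exact: allpairs_f_dep ys18 jys.
Qed.

Let K_B_reduce j u : (j < 5)%N ->
    (forall ys, ys \in nonpivots st18.1 4 18 ->
       inspan rows (B_elt j (fun i => X i * mono ys))) ->
  u \is 18.-homog -> inspan rows (B_elt j (fun i => X i * u)).
Proof.
move=> ltj Km.
apply: (stage_reduce (isT : (18 < 20)%N) ks18P E18 K0 KD
  (T := fun u => B_elt j (fun i => X i * u)) _ _ _ Km).
- by apply: big1 => i _; rewrite mulr0 part0.
- by move=> p q; rewrite -B_eltD; apply: eq_bigr => i _; rewrite mulrDr.
move=> k v kks hv; have /andP[k_gt0 lek] := ks18P kks.
apply: (K_B_even K0 KD Kpair ltj k_gt0 _ lek hv).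
by move: k kks {k_gt0 lek hv}; apply/allP.
Qed.

Let sub14 : {subset iota 1 4 <= iota 0 5}.
Proof. exact/allP. Qed.

Let K_B1 j u : j \in iota 1 4 -> u \is 18.-homog ->
  inspan rows (B_elt j (fun i => X i * u)).
Proof.
move=> j1; have ltj : (j < 5)%N by move: j1; rewrite mem_iota; case/andP.
apply: (K_B_reduce ltj) => ys ys18.
have jys : j \in (if nth 0%N ys 0 == 0%N then iota 0 5 else iota 1 4).
  by case: ifP => _; [exact: sub14|exact: j1].
exact (K_B_mono ltj ys18 jys).
Qed.

Let KB j u : (j < 5)%N -> u \is 18.-homog ->
  inspan rows (B_elt j (fun i => X i * u)).
Proof.
have [-> _|j_gt0 ltj] := posnP j; last by apply: K_B1; rewrite mem_iota j_gt0.
apply: (K_B_reduce (isT : (0 < 5)%N)) => ys ys18.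
have [y0|ny0] := eqVneq (nth 0%N ys 0) 0%N.
  have jys : 0%N \in (if nth 0%N ys 0 == 0%N then iota 0 5 else iota 1 4).
    by rewrite y0 mem_iota.
  exact (K_B_mono (isT : (0 < 5)%N) ys18 jys).
move: ys18; rewrite mem_nonpivots => /and3P[_ /eqP sz /eqP sy].
(* Here the monomial is x_0 times that of zs, and [sum_B_elt] writes its element for j = 0 as a sum
   of elements for j = 1, ..., 4. *)
pose zs := set_nth 0%N ys 0 (nth 0%N ys 0).-1.
have ysE : ys = incr 0 zs.
  by case: ys sz ny0 @zs {sy} => [|[|y] ys].
have szz : size zs = 5%N by rewrite size_set_nth sz.
have [_ syz mz] := incrP szz (isT : (0 < 5)%N).
move: (sum_B_elt (mono zs)); rewrite big_cons -mz -ysE => s0.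
apply: (K_addr KD (q := \sum_(j <- iota 1 4)
  B_elt j (fun i => X i * (X j * mono zs)))); last by rewrite s0; exact: K0.
rewrite big_seq; apply: (K_sum K0 KD) => i i1; apply: (K_B1 i1).
have hz : mono zs \is 17.-homog.
  have <- : sumn zs = 17%N by move: syz; rewrite -ysE sy => -[].
  exact: mono_homog.
exact: (dhomogM (X_homog i) hz).
Qed.

Let KC u : u \is 17.-homog -> inspan rows (C_elt u).
Proof.
apply: (stage_reduce (isT : (17 < 20)%N) ks17P E17 K0 KD (T := C_elt)).
- rewrite /C_elt Sq0r part0 add0r; apply: big1 => ik _.
  by rewrite !mulr0 part0.
- exact: C_eltD.
- move=> k v; rewrite inE => /eqP-> hv; exact: (K_C_Sq1 K0 KD Kpair KB hv).
move=> ys ys17; have := ys17; rewrite mem_nonpivots => /and3P[_ /eqP sz /eqP sy].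
have [KCv _] := C_rowP K0 KD (tab19P K0 KD K19) (tab18P K0 KD K18) sz sy.
apply: (K_addr KD _ KCv); apply: Kv; rewrite mem_cat; apply/orP; right.
exact: map_f ys17.
Qed.

Lemma hit_inspan_rows p : p \is 41.-homog -> hit p -> inspan rows p.
Proof.
move=> hp /(K_pihomog_hit K0 KD Klow Kpair Keven KB KC).
by rewrite (pihomog_dE hp).
Qed.

End Assembly.

(** * Dimension count *)

Lemma hit_pihomog n p : hit p -> hit (pihomog mdeg n p).
Proof.
apply: hit_pihomog_rec => [||k ys k_gt0 _ _]; [exact: hit0|exact: hitD|].
exact: hit_Sq.
Qed.

Section HitDimension.
Variable n : nat.

Let proj p : dhomog 5 'F_2 n := DHomog (pihomogP mdeg n p).

Let projD p q : proj (p + q) = proj p + proj q.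
Proof. by apply: val_inj; rewrite /= pihomogD. Qed.

Let proj_val (x : dhomog 5 'F_2 n) : proj (val x) = x.
Proof. by apply: val_inj; rewrite /= pihomog_dE ?dhomog_is_dhomog. Qed.

Let inspan_span s p : inspan s p -> proj p \in <<map proj s>>%VS.
Proof.
elim=> {p} [|p q _ IHp _ IHq|p ps].
- have -> : proj 0 = 0 by apply: val_inj; rewrite /= pihomog0.
  exact: mem0v.
- by rewrite projD memvD.
by rewrite memv_span // map_f.
Qed.

Let dim_map_span s : (\dim <<map proj s>>%VS <= size s)%N.
Proof. by rewrite -(size_map proj s) dim_span. Qed.

Lemma dim_hit_le s : (forall p, p \is n.-homog -> hit p -> inspan s p) ->
  (\dim (hit_vs 4 n) <= size s)%N.
Proof.
move=> hs; apply: leq_trans (dim_map_span s); apply: dimvS; apply/subvP => x.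
move/mem_hit_vs => hx; rewrite -(proj_val x); apply: inspan_span.
exact: hs (dhomog_is_dhomog x) hx.
Qed.

Lemma dim_hit_ge s :
    (forall p, p \is n.-homog -> exists2 q, inspan s q & hit (p + q)) ->
  ('C(n + 4, n) <= \dim (hit_vs 4 n) + size s)%N.
Proof.
move=> hs; have <- : \dim {: dhomog 5 'F_2 n} = 'C(n + 4, n) by rewrite dimvf.
apply: leq_trans (leq_add (leqnn _) (dim_map_span s)).
apply: leq_trans (dimv_add_leqif _ _); apply: dimvS; apply/subvP => x _.
have [q sq hq] := hs _ (dhomog_is_dhomog x).
(* Nothing says that q is homogeneous, so both terms are projected to degree n. *)
have -> : x = proj (val x + q) + proj q.
  by rewrite -[in RHS]projD addPK proj_val.
apply: memv_add; last exact: inspan_span.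
by apply/mem_hit_vs; apply: hit_pihomog.
Qed.

End HitDimension.

(** The products keep the numerals small. There remain 8855 - 7950 = 905 monomials in degree 19 and
    7315 - 5310 = 2005 in degree 18, and 10 * 905 + 2005 - 8425 = 2630. *)
Definition check_ranks (fuel : nat) (par : seq (seq bool)) : bool :=
  match helim fuel (hrels par 19 (iota 1 9)),
        helim fuel (hrels par 18 [:: 2; 4; 6; 8]%N),
        helim fuel (hrels par 17 [:: 1%N]) with
  | Some st19, Some st18, Some st17 =>
      match helim fuel (vrels par (hnf_table fuel st19.1 19)
              (hnf_table fuel st18.1 18) st18.1 st17.1) with
      | Some st => [&& size st19.2 == 75 * 106, size st18.2 == 59 * 90,
          size st.2 == 25 * 337 & size (vnonpivots st19.1 st18.1 st.1) == 2630]%N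
      | None => false
      end
  | _, _, _ => false
  end.

(** The fuel bounds the steps of each single reduction; were it too small for an insertion, the
    check would yield [false]. *)
Lemma check_ranksT : check_ranks (2 ^ 10) parities.
Proof. by vm_cast_no_check (erefl true). Qed.

Lemma size_expos_20 : size (expos 4 20) = (42 * 253)%N.
Proof. by apply/eqP; vm_compute. Qed.

Lemma size_rows st19 st18 st : size (rows st19 st18 st) =
  (5 * (42 * 253) + (10 * size st19.2 + (size st18.2 + size st.2)))%N.
Proof.
rewrite /rows size_cat size_allpairs size_iota size_expos_20; congr (_ + _)%N.
by rewrite size_cat size_allpairs size_cat !size_map.
Qed.

Lemma bin_add4 n :
  ('C(n + 4, n) * 24 = (n + 4) * ((n + 3) * ((n + 2) * (n + 1))))%N.
Proof.
have -> : 'C(n + 4, n) = 'C(n + 4, 4) by rewrite -(bin_sub (leq_addl n 4)) addnK.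
have := bin_ffact (n + 4) 4; rewrite !ffactnS ffactn0 => ->.
by rewrite !addnS addn0 muln1.
Qed.

(** With [fuel] a variable, no conversion test can run the elimination here. *)
Lemma check_ranks_dim fuel :
  check_ranks fuel parities -> \dim {: Q5 41} = 2630%N.
Proof.
rewrite /check_ranks.
destruct (helim fuel (hrels parities 19 (iota 1 9))) as [st19|] eqn:E19;
  last discriminate.
destruct (helim fuel (hrels parities 18 _)) as [st18|] eqn:E18; last discriminate.
destruct (helim fuel (hrels parities 17 _)) as [st17|] eqn:E17; last discriminate.
destruct (helim fuel (vrels _ _ _ _ _)) as [st|] eqn:E; last discriminate.
case/and4P=> /eqP s19 /eqP s18 /eqP sv /eqP sb.
have lower := dim_hit_le (hit_inspan_rows erefl erefl E19 E18 E17 E).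
have upper := dim_hit_ge (homog_spanned erefl erefl E19 E18 E).
rewrite size_rows s19 s18 sv in lower; rewrite size_map sb in upper.
(* There are 53130 + 79500 + 5310 + 8425 = 146365 rows, and C(45, 4) = 148995 = 146365 + 2630, so
   the two bounds meet. *)
rewrite dim_Q5; have := bin_add4 41; move: ('C(_, _)) (\dim _) lower upper.
by lia.
Qed.

Local Close Scope ring_scope.

Theorem corollary2p4 (s : nat) (s_gt0 : 0 < s) :
  \dim {: Q5 (5 * (2 ^ s - 1) + 18 * 2 ^ s)} = 2630.
Proof. exact (etrans (dim_Q5_41 s_gt0) (check_ranks_dim check_ranksT)). Qed.
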